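(* Let $1\le t\le f\le n$, let $T$ be an intersection type of size $t$, let $\mathcal{F}^f_T$ be the set of $T$-flags of size $f$ (up to label-preserving isomorphism) not containing $A$ as an induced subgraph, and let $Q$ be a positive semidefinite $|\mathcal{F}^f_T|\times|\mathcal{F}^f_T|$ matrix. For each injective $\Theta:[t]\to[n]$ let $\mathbf{d}^{\Theta,T,f}:=(\mathsf{d}^\Theta_F)_{F\in\mathcal{F}^f_T}$. Let $d$ be at least the degree of every $\mathsf{d}^\Theta_F$ and $V=\mathbb{R}[\mathbf{x}]_{\le d}$. Then the sum of squares $\mathbb{E}_\Theta\,{\mathbf{d}^{\Theta,T,f}}^\top Q\,\mathbf{d}^{\Theta,T,f}$ (expectation over $\Theta$ uniformly distributed on the injective maps $[t]\to[n]$) can be obtained by restricting the Gatermann–Parrilo SDP to the partitions $\boldsymbol{\mu}\ge_{\mathrm{lex}}(n-t,1^t)$: there exist positive semidefinite $Q_{\boldsymbol{\mu}}\in\mathbb{R}^{m_{\boldsymbol{\mu}}\times m_{\boldsymbol{\mu}}}$ for the partitions $\boldsymbol{\mu}$ of $n$ with $\boldsymbol{\mu}\ge_{\mathrm{lex}}(n-t,1^t)$ such that $\mathbb{E}_\Theta\,{\mathbf{d}^{\Theta,T,f}}^\top Q\,\mathbf{d}^{\Theta,T,f}=\sum_{\boldsymbol{\mu}\ge_{\mathrm{lex}}(n-t,1^t)}\langle Q_{\boldsymbol{\mu}},Y_{\boldsymbol{\mu}}\rangle$.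
   Context: $A$ is a fixed graph. $\mathbb{R}[\mathbf{x}]$ is the polynomial ring in $\mathsf{x}_{ij}$, $1\le i<j\le n$ ($\mathsf{x}_{ji}:=\mathsf{x}_{ij}$); $\mathfrak{S}_n$ acts by $\mathfrak{s}\,\mathsf{x}_{ij}:=\mathsf{x}_{\mathfrak{s}(i)\mathfrak{s}(j)}$, extended multiplicatively and linearly. An intersection type of size $t$ is a graph $T$ on $t$ vertices labeled by distinct elements of $[t]$; a $T$-flag of size $f$ is a graph $F$ on $f$ vertices in which $t$ vertices carry the distinct labels $1,\dots,t$ and induce $T$ with identical labels. For injective $h:V(F)\to[n]$, $\mathsf{p}^h_F:=\prod_{\{u,v\}\in E(F)}\mathsf{x}_{h(u)h(v)}\prod_{\{u,v\}\in\binom{V(F)}{2}\setminus E(F)}(1-\mathsf{x}_{h(u)h(v)})$; $\mathrm{Inj}_\Theta(V(F),[n])$ is the set of injective $h:V(F)\to[n]$ with $h(v)=\Theta(i)$ whenever $v$ is labeled $i$; $\mathsf{d}^\Theta_F:=\frac{1}{|\mathrm{Inj}_\Theta(V(F),[n])|}\sum_{h\in\mathrm{Inj}_\Theta(V(F),[n])}\mathsf{p}^h_F$. Partitions of $n$ have parts $\mu_1\ge\mu_2\ge\dots>0$; $\ge_{\mathrm{lex}}$ is lexicographic order on part vectors; $(n-t,1^t)$ has parts $n-t$ and $t$ ones. For a partition $\boldsymbol{\lambda}$ of $n$, $V_{\boldsymbol{\lambda}}$ is the sum of all $\mathfrak{S}_n$-submodules of $V$ isomorphic to the Specht module $S^{\boldsymbol{\lambda}}$;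 $n_{\boldsymbol{\lambda}}=\dim S^{\boldsymbol{\lambda}}$ and $m_{\boldsymbol{\lambda}}$ is the multiplicity of $S^{\boldsymbol{\lambda}}$ in $V$. Fix a decomposition $V_{\boldsymbol{\lambda}}=\bigoplus_{i=1}^{m_{\boldsymbol{\lambda}}}V^i_{\boldsymbol{\lambda}}$ into irreducibles and bases $(b^i_{\boldsymbol{\lambda},1},\dots,b^i_{\boldsymbol{\lambda},n_{\boldsymbol{\lambda}}})$ of $V^i_{\boldsymbol{\lambda}}$ such that each $\mathfrak{s}\in\mathfrak{S}_n$ has the same matrix on $V^i_{\boldsymbol{\lambda}}$ for all $i$ (a symmetry-adapted basis). Let $\mathbf{y}_{\boldsymbol{\lambda}}:=(b^1_{\boldsymbol{\lambda},1},\dots,b^{m_{\boldsymbol{\lambda}}}_{\boldsymbol{\lambda},1})^\top$, $Y_{\boldsymbol{\lambda}}:=\frac{1}{n!}\sum_{\mathfrak{s}\in\mathfrak{S}_n}\mathfrak{s}(\mathbf{y}_{\boldsymbol{\lambda}}\mathbf{y}_{\boldsymbol{\lambda}}^\top)$ (entrywise action), and $\langle Q,Y\rangle:=\sum_{a,b}Q_{ab}Y_{ab}$. *)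

(* Defs.v *)
From HB Require Import structures.
From mathcomp Require Export all_boot all_order all_algebra all_fingroup.
From mathcomp Require Export reals.
From mathcomp Require Export mpoly.

Set Implicit Arguments.
Unset Strict Implicit.
Unset Printing Implicit Defensive.

Import Order.TTheory GRing.Theory Num.Theory.

Local Open Scope ring_scope.

Record sgraph (k : nat) := SGraph {
  adj : rel 'I_k;
  adj_sym : ssrbool.symmetric adj;
  adj_irr : irreflexive adj }.

Definition contains_induced (a f : nat) (A : sgraph a) (F : sgraph f) : Prop :=
  exists2 phi : 'I_a -> 'I_f, injective phi &
    forall u v, adj F (phi u) (phi v) = adj A u v.

(* An intersection type of size t is a graph whose vertices carry all the
   labels in [t]; its vertices are identified with their labels, so that it is
   an [sgraph t].  All the labels below are shifted by one ('I_t for [t]). *)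
Record flag (t : nat) (T : sgraph t) (f : nat) := Flag {
  flag_graph : sgraph f;
  label : 'I_t -> 'I_f;
  label_inj : injective label;
  label_adj : forall i j, adj flag_graph (label i) (label j) = adj T i j }.

Definition flag_iso (t : nat) (T : sgraph t) (f : nat) (F G : flag T f) : Prop :=
  exists s : 'S_f,
    (forall u v, adj (flag_graph G) (s u) (s v) = adj (flag_graph F) u v) /\
    (forall i, s (label F i) = label G i).

(* Fl lists exactly one representative of each label-preserving isomorphism
   class of T-flags of size f without induced copy of A, i.e., it is an
   enumeration of F^f_T. *)
Definition flag_enumeration (a : nat) (A : sgraph a) (t : nat) (T : sgraph t)
    (f N : nat) (Fl : 'I_N -> flag T f) : Prop :=
  [/\ forall i, ~ contains_induced A (flag_graph (Fl i)),
      forall F : flag T f, ~ contains_induced A (flag_graph F) ->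
        exists i, flag_iso F (Fl i)
    & forall i j, flag_iso (Fl i) (Fl j) -> i = j].

Definition edge (n : nat) : finType := {p : 'I_n * 'I_n | (p.1 < p.2)%N}.

Definition edgepoly (R : realType) (n : nat) := {mpoly R[#|edge n|]}.

(* Junk value 0 for i = j. *)
Definition xvar (R : realType) (n : nat) (i j : 'I_n) : edgepoly R n :=
  if insub (i, j) is Some e then 'X_(enum_rank (e : edge n))
  else if insub (j, i) is Some e then 'X_(enum_rank (e : edge n))
  else 0.

Definition edge_act (R : realType) (n : nat) (s : 'S_n) (p : edgepoly R n) :
    edgepoly R n :=
  p \mPo [tuple xvar R (s (val (enum_val k)).1) (s (val (enum_val k)).2)
          | k < #|edge n|].

Definition poly_le (R : realType) (n d : nat) (p : edgepoly R n) : Prop :=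
  (msize p <= d.+1)%N.

Definition flag_mono (R : realType) (n f : nat) (F : sgraph f)
    (h : 'I_f -> 'I_n) : edgepoly R n :=
  (\prod_(p : 'I_f * 'I_f | (p.1 < p.2)%N && adj F p.1 p.2)
     xvar R (h p.1) (h p.2)) *
  (\prod_(p : 'I_f * 'I_f | (p.1 < p.2)%N && ~~ adj F p.1 p.2)
     (1 - xvar R (h p.1) (h p.2))).

Definition Inj (t n : nat) : {set {ffun 'I_t -> 'I_n}} :=
  [set Theta : {ffun 'I_t -> 'I_n} | injectiveb Theta].

Definition Inj_ext (t : nat) (T : sgraph t) (f n : nat) (F : flag T f)
    (Theta : 'I_t -> 'I_n) : {set {ffun 'I_f -> 'I_n}} :=
  [set h in Inj f n | [forall i, h (label F i) == Theta i]].

Definition density (R : realType) (t : nat) (T : sgraph t) (f n : nat)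
    (F : flag T f) (Theta : 'I_t -> 'I_n) : edgepoly R n :=
  (#|Inj_ext F Theta|%:R^-1 : R) *:
    \sum_(h in Inj_ext F Theta) flag_mono R (flag_graph F) h.

Definition psd (R : realType) (k : nat) (Q : 'M[R]_k) : Prop :=
  Q^T = Q /\ forall v : 'rV[R]_k, 0 <= (v *m Q *m v^T) 0 0.

Definition expected_sos (R : realType) (t : nat) (T : sgraph t) (f n N : nat)
    (Fl : 'I_N -> flag T f) (Q : 'M[R]_N) : edgepoly R n :=
  (#|Inj t n|%:R^-1 : R) *:
    \sum_(Theta in Inj t n) \sum_(i < N) \sum_(j < N)
      Q i j *: (density R (Fl i) Theta * density R (Fl j) Theta).

Definition is_partition (n : nat) (s : seq nat) : bool :=
  [&& sorted geq s, all (fun k => 0 < k)%N s & sumn s == n].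

(* A partition of n has at most n parts, all of them at most n. *)
Definition partn (n : nat) : finType :=
  {s : n.-bseq 'I_n.+1 | is_partition n (map val s)}.

Definition parts (n : nat) (l : partn n) : seq nat :=
  map (@nat_of_ord n.+1) (val l).

(* (n - t, 1^t); the null part is removed when t = n. *)
Definition hook (n t : nat) : seq nat :=
  [seq k <- (n - t)%N :: nseq t 1%N | (0 < k)%N].

Definition lex_ge (mu nu : seq nat) : bool :=
  ((nu : seqlexi nat) <= (mu : seqlexi nat))%O.

Section SnModules.

Variables (R : realType) (n : nat).

Definition submodule (U : lmodType R) (act : 'S_n -> U -> U)
    (W : U -> Prop) : Prop :=
  [/\ W 0, forall (c : R) x y, W x -> W y -> W (c *: x + y)
    & forall s x, W x -> W (act s x)].

Definition irreducible_submodule (U : lmodType R) (act : 'S_n -> U -> U)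
    (W : U -> Prop) : Prop :=
  [/\ submodule act W, exists2 x, W x & x != 0
    & forall W' : U -> Prop, submodule act W' -> (forall x, W' x -> W x) ->
        (forall x, W' x -> x = 0) \/ (forall x, W x -> W' x)].

Definition submodule_iso (U U' : lmodType R)
    (act : 'S_n -> U -> U) (act' : 'S_n -> U' -> U')
    (W : U -> Prop) (W' : U' -> Prop) : Prop :=
  exists phi : U -> U',
    [/\ forall (c : R) x y, W x -> W y -> phi (c *: x + y) = c *: phi x + phi y,
        forall s x, W x -> phi (act s x) = act' s (phi x),
        forall x, W x -> phi x = 0 -> x = 0
      & forall y, W' y <-> exists2 x, W x & phi x = y].

(* The sum of all submodules of V isomorphic to the module W'. *)
Definition isotypic (U U' : lmodType R)
    (act : 'S_n -> U -> U) (act' : 'S_n -> U' -> U')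
    (V : U -> Prop) (W' : U' -> Prop) (x : U) : Prop :=
  exists (k : nat) (w : 'I_k -> U),
    x = \sum_(i < k) w i /\
    forall i, exists W : U -> Prop,
      [/\ submodule act W, forall y, W y -> V y,
          submodule_iso act act' W W' & W (w i)].

Definition direct_sum (U : lmodType R) (V : U -> Prop) (k : nat)
    (W : 'I_k -> U -> Prop) : Prop :=
  (forall x, V x <->
     exists2 w : 'I_k -> U, forall i, W i (w i) & x = \sum_(i < k) w i) /\
  (forall w : 'I_k -> U, (forall i, W i (w i)) -> \sum_(i < k) w i = 0 ->
     forall i, w i = 0).

Definition lin_free (U : lmodType R) (k : nat) (b : k.-tuple U) : Prop :=
  forall c : 'I_k -> R, \sum_(j < k) c j *: tnth b j = 0 -> forall j, c j = 0.

Definition lin_span (U : lmodType R) (k : nat) (b : k.-tuple U) (x : U) : Prop :=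
  exists c : 'I_k -> R, x = \sum_(j < k) c j *: tnth b j.

(* A tabloid is the sequence of its rows; unused rows are empty. *)
Definition tabloid : finType := {ffun 'I_n -> {set 'I_n}}.

(* The permutation module spanned by all tabloids of all shapes; it contains
   the modules M^l for all the partitions l of n. *)
Definition tabloid_space : vectType R := {ffun tabloid -> R^o}.

Definition tabloid_act (s : 'S_n) (v : tabloid_space) : tabloid_space :=
  [ffun X : tabloid => v [ffun i => (s^-1)%g @: X i]].

(* The cells of the Young diagram of l are numbered row by row from 0 to n-1.
   The permutation t encodes the tableau with entry t k in the cell number k.
   Products of permutations are read from left to right: the tableau t * s is
   the result of applying s to the entries of t. *)
Definition entry_row (l : partn n) (t : 'S_n) (x : 'I_n) : nat :=
  reshape_index (parts l) (t^-1 x)%g.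

Definition entry_col (l : partn n) (t : 'S_n) (x : 'I_n) : nat :=
  reshape_offset (parts l) (t^-1 x)%g.

Definition tabloid_of (l : partn n) (t : 'S_n) : tabloid :=
  [ffun i : 'I_n => [set x | entry_row l t x == i]].

Definition col_stab (l : partn n) (t : 'S_n) : {set 'S_n} :=
  [set s : 'S_n | [forall x, entry_col l t (s x) == entry_col l t x]].

Definition polytabloid (l : partn n) (t : 'S_n) : tabloid_space :=
  \sum_(s in col_stab l t)
    ((-1) ^+ odd_perm s : R) *:
      ([ffun X : tabloid => (X == tabloid_of l (t * s)%g)%:R] : tabloid_space).

Definition specht (l : partn n) : {vspace tabloid_space} :=
  <<[seq polytabloid l t | t : 'S_n]>>%VS.

(* (b i)_i is the family of bases in a symmetry-adapted basis for the isotypic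
   component V_l of V: V_l is the direct sum of the m irreducible submodules
   spanned by the b i, of which b i is a basis, and every s has the same matrix
   M in all these bases. *)
Definition symmetry_adapted (U : lmodType R) (act : 'S_n -> U -> U)
    (V : U -> Prop) (l : partn n) (m : nat)
    (b : 'I_m -> (\dim (specht l)).-tuple U) : Prop :=
  [/\ forall i, lin_free (b i),
      forall i, irreducible_submodule act (lin_span (b i)),
      direct_sum (isotypic act tabloid_act V (fun v => v \in specht l))
        (fun i => lin_span (b i))
    & forall s : 'S_n, exists M : 'M[R]_(\dim (specht l)), forall i j,
        act s (tnth (b i) j) = \sum_k M k j *: tnth (b i) k].

End SnModules.

Definition Ymat (R : realType) (n m k : nat)
    (b : 'I_m -> k.-tuple (edgepoly R n)) : 'M[edgepoly R n]_m :=
  \matrix_(i, j) ((n`!%:R^-1 : R) *: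
     \sum_(s : 'S_n) edge_act s ((b i)`_0 * (b j)`_0)).

Definition mxpair (R : realType) (n m : nat) (Q : 'M[R]_m)
    (Y : 'M[edgepoly R n]_m) : edgepoly R n :=
  \sum_i \sum_j Q i j *: Y i j.

(* Main.v *)
Require Import Defs.
From mathcomp Require Import boolp.

Import Order.TTheory GRing.Theory Num.Theory.
Local Open Scope ring_scope.

(* Write A_s for the action of a permutation s, e_t for the polytabloid of a
   tableau t, and kappa_t for its signed column sum.  Moving kappa_t across an
   invariant bilinear form and using kappa_t y = <y, e_t> e_t on S^l shows that
   such a form vanishes on S^l x S^mu for l <> mu, and that on S^l x S^l it is
   <., .> times a constant; this plays the role of Schur's lemma.

   Hence the class functions g_l(s) = sum_t <A_s e_t, e_t> are orthogonal.
   There are as many of them as partitions of n, so they span the class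
   functions, and sum_l c_l g_l is the indicator of the identity for some c.
   Therefore every x in a module U is sum_l sum_t theta_t(c_l e_t), where
   theta_t(y) = sum_s <y, A_s e_t> s x is an equivariant map S^l -> U.  If a
   transposition of the column group of t fixes x, then theta_t = 0.  A density
   d^Theta is fixed by the permutations of the n - t points outside the image of
   Theta, and two of these points share a column of t as soon as l_1 < n - t;
   so only the shapes l with l_1 >= n - t, which are those with
   l >=lex (n - t, 1^t), contribute.

   In a symmetry-adapted basis, the b^i_j are the images of common vectors v_j
   of S^l under equivariant maps, so the average of s(b^i_j b^k_j') is
   <v_j, v_j'> u_ik, and Y_ik = <v_0, v_0> u_ik.  The matrix Q_l is thus, up to
   the factor 1 / <v_0, v_0>, a sum over the tabloids X of matrices
   G_X^T Q G_X. *)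

Set Implicit Arguments.
Unset Strict Implicit.
Unset Printing Implicit Defensive.

(** * Tableaux and dominance *)

Section Tableaux.

Local Open Scope nat_scope.

Variables (T : finType) (lam : seq nat) (r c : T -> nat).

Definition is_tableau : Prop :=
  [/\ sorted geq lam, forall x, c x < nth 0 lam (r x),
      forall i j, j < nth 0 lam i -> exists x, r x = i /\ c x = j
    & forall x y, r x = r y -> c x = c y -> x = y].

Lemma card_fibers (K : nat) (g : T -> nat) (P : pred T) :
  (forall x, g x < K) ->
  #|[pred x | P x]| = \sum_(j < K) #|[pred x | P x && (g x == j)]|.
Proof.
move=> gK; rewrite -sum1_card (partition_big (fun x => Ordinal (gK x)) predT) //=.
by apply: eq_bigr => j _; rewrite sum1_card.
Qed.

Lemma nth_sorted_geq (s : seq nat) i j :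
  sorted geq s -> i <= j -> nth 0 s j <= nth 0 s i.
Proof.
move=> ss ij; have [js|sj] := ltnP j (size s); last by rewrite nth_default.
by apply: (sorted_leq_nth _ _ 0 ss) => //; rewrite ?inE ?(leq_ltn_trans ij) //;
  [move=> a b d /= ? ?; apply: (@leq_trans a) | move=> a /=].
Qed.

Variable r' : T -> nat.
Hypothesis tab : is_tableau.
Hypothesis inj_r' : forall x y, c x = c y -> r' x = r' y -> x = y.

(** If column [j] reaches row [i] or beyond, it has a cell in each row before [i], so the right side
    is at least [i], while [r'], injective on the column, takes at most [i] values below [i].
    Otherwise the right side counts the whole column. *)
Lemma column_le i j :
  #|[pred x | (r' x < i) && (c x == j)]| <= #|[pred x | (r x < i) && (c x == j)]|.
Proof.
have [slam cl cells rc_inj] := tab.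
have [/existsP[x /andP[/eqP cx rx]]|/existsPn H] :=
  boolP [exists x, (c x == j) && (i <= r x)]; last first.
  apply: subset_leq_card; apply/subsetP => x; rewrite !inE => /andP[_ cx].
  by move: (H x); rewrite cx /= -ltnNge => ->.
have gP (k : 'I_i) : exists y, r y = k /\ c y = j.
  apply: cells; rewrite -cx; apply: leq_trans (cl x) _.
  by apply: nth_sorted_geq => //; apply: leq_trans (ltnW (ltn_ord k)) rx.
have [g gE] := fin_all_exists gP.
apply: (@leq_trans i).
  rewrite cardE -(size_map r') -[X in _ <= X](size_iota 0).
  apply: uniq_leq_size.
    rewrite map_inj_in_uniq ?enum_uniq // => y z.
    rewrite !mem_enum !inE => /andP[_ /eqP cy] /andP[_ /eqP cz] e.
    by apply: inj_r'; rewrite ?cy ?cz.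
  move=> k /mapP[y]; rewrite mem_enum inE => /andP[ry _] ->.
  by rewrite mem_iota.
rewrite -{1}(card_ord i) -(card_imset _ (f := g)); last first.
  by move=> k l /(congr1 r); case: (gE k) (gE l) => -> _ [-> _] /val_inj.
apply: subset_leq_card; apply/subsetP => y /imsetP[k _ ->].
by rewrite !inE; case: (gE k) => -> ->; rewrite ltn_ord eqxx.
Qed.

Let K := (\max_x c x).+1.

Let cK x : c x < K.
Proof. by rewrite ltnS; apply: leq_bigmax. Qed.

Lemma tableau_dominance i : #|[pred x | r' x < i]| <= #|[pred x | r x < i]|.
Proof.
rewrite !(card_fibers _ cK); apply: leq_sum => j _; exact: column_le.
Qed.

(** Equal totals turn all the inequalities of [column_le] into equalities; comparing [i] with
    [i.+1], each column has as many entries with [r'] equal to [i] as with [r] equal to [i]. *)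
Lemma tableau_column_match :
  (forall i, #|[pred x | r' x < i]| = #|[pred x | r x < i]|) ->
  forall x, exists y, c y = c x /\ r' y = r x.
Proof.
move=> eq_rows x.
have eqc i (j : 'I_K) :
    #|[pred x | (r' x < i) && (c x == j)]| = #|[pred x | (r x < i) && (c x == j)]|.
  have /leqif_sum : forall j : 'I_K, true ->
      #|[pred x | (r' x < i) && (c x == j)]| <=
      #|[pred x | (r x < i) && (c x == j)]| ?=
      iff (#|[pred x | (r' x < i) && (c x == j)]| ==
           #|[pred x | (r x < i) && (c x == j)]|).
    by move=> k _; split=> //; apply: column_le.
  rewrite -!(card_fibers _ cK) eq_rows => -[_ /esym].
  by rewrite eqxx => /forall_inP/(_ j isT)/eqP.
have split_row (s : T -> nat) i (j : 'I_K) :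
    #|[pred x | (s x < i.+1) && (c x == j)]| =
    #|[pred x | (s x < i) && (c x == j)]| + #|[pred x | (s x == i) && (c x == j)]|.
  rewrite -(cardID [pred x | s x < i]); congr (_ + _); apply: eq_card => y.
    by rewrite !inE ltnS; case: (ltngtP (s y) i); rewrite /= ?andbT ?andbF.
  by rewrite !inE ltnS; case: (ltngtP (s y) i); rewrite /= ?andbT ?andbF.
pose j := Ordinal (cK x).
have: #|[pred y | (r' y == r x) && (c y == j)]| =
      #|[pred y | (r y == r x) && (c y == j)]|.
  by apply: (@addnI #|[pred y | (r' y < r x) && (c y == j)]|);
    rewrite -split_row !eqc split_row.
move=> E; have: 0 < #|[pred y | (r' y == r x) && (c y == j)]|.
  by rewrite E; apply/card_gt0P; exists x; rewrite inE !eqxx.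
by case/card_gt0P => y; rewrite inE => /andP[/eqP ? /eqP ?]; exists y.
Qed.

End Tableaux.

Section TableauRows.

Local Open Scope nat_scope.

Variables (T : finType) (lam : seq nat) (r c : T -> nat).
Hypothesis tab : is_tableau lam r c.

Lemma card_tableau_row i : #|[pred x | r x == i]| = nth 0 lam i.
Proof.
have [_ cl cells rc_inj] := tab.
have gP (k : 'I_(nth 0 lam i)) : exists y, r y = i /\ c y = k by apply: cells.
have [g gE] := fin_all_exists gP.
rewrite -[RHS]card_ord -(card_imset _ (f := g)); last first.
  by move=> k l /(congr1 c); case: (gE k) (gE l) => _ -> [_ ->] /val_inj.
apply: eq_card => x; rewrite !inE; apply/eqP/imsetP => [rx|[k _ ->]].
  have cx : c x < nth 0 lam i by rewrite -rx.
  exists (Ordinal cx) => //.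
  by case: (gE (Ordinal cx)) => rg cg; apply: rc_inj; rewrite ?rg ?cg.
by case: (gE k).
Qed.

Lemma card_tableau_rows i :
  #|[pred x | r x < i]| = \sum_(k < i) nth 0 lam k.
Proof.
elim: i => [|i IHi]; first by rewrite big_ord0 eq_card0.
rewrite big_ord_recr /= -IHi -card_tableau_row.
rewrite -(cardID [pred x | r x < i]); congr (_ + _); apply: eq_card => x.
  by rewrite !inE ltnS; case: (ltngtP (r x) i).
by rewrite !inE ltnS; case: (ltngtP (r x) i).
Qed.

End TableauRows.

(** * Tableaux of partition shape, tabloids and column groups *)

Section Partitions.

Variable n : nat.
Implicit Types (l mu : partn n) (t s g : 'S_n).

Lemma partsP l :
  [/\ sorted geq (parts l), all (fun k => 0 < k)%N (parts l)
    & sumn (parts l) = n].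
Proof. by have /and3P[? ? /eqP] := valP l. Qed.

Lemma parts_inj : injective (@parts n).
Proof. by move=> l mu E; apply/val_inj/val_inj/(inj_map val_inj). Qed.

Lemma eq_parts l mu :
  (forall i, nth 0%N (parts l) i = nth 0%N (parts mu) i) -> l = mu.
Proof.
move=> E; apply: parts_inj.
have le_size l1 l2 : (forall i, nth 0%N (parts l1) i = nth 0%N (parts l2) i) ->
    (size (parts l1) <= size (parts l2))%N.
  move=> {}E; rewrite leqNgt; apply/negP => lt_s.
  have [_ /all_nthP pos _] := partsP l1.
  by have := pos 0%N _ lt_s; rewrite E nth_default.
apply: (eq_from_nth (x0 := 0%N)) => [|i _]; last exact: E.
by apply/eqP; rewrite eqn_leq !le_size.
Qed.

Lemma entry_tableau l t : is_tableau (parts l) (entry_row l t) (entry_col l t).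
Proof.
have [sl pos suml] := partsP l.
rewrite /entry_row /entry_col; split=> // [x|i j ij|x y rxy cxy].
- by apply: reshape_offsetP; rewrite suml.
- have := flatten_indexP ij; rewrite suml => lt_n.
  exists (t (Ordinal lt_n)); rewrite permK /=.
  by rewrite flatten_indexKl // flatten_indexKr.
- apply: (@perm_inj _ t^-1%g); apply: val_inj => /=.
  rewrite -[LHS](reshape_indexK (parts l)) -[RHS](reshape_indexK (parts l)).
  by congr flatten_index.
Qed.

(** Tabloids have their rows indexed by ['I_n]; this bound ensures that no entry is lost, so that a
    tabloid determines its row function. *)
Lemma entry_row_lt l t x : (entry_row l t x < n)%N.
Proof.
have [_ pos suml] := partsP l.
have lt_s : (entry_row l t x < size (parts l))%N.
  by apply: reshape_indexP; rewrite suml.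
apply: leq_trans lt_s _; rewrite -[leqRHS]suml; elim: (parts l) pos => //= k s IHs.
by case/andP => k0 /IHs; rewrite -(leq_add2l 1) add1n => /leq_trans -> //;
  rewrite leq_add2r.
Qed.

Lemma entry_rowM l t s x : entry_row l (t * s)%g x = entry_row l t (s^-1 x)%g.
Proof. by rewrite /entry_row invMg permM. Qed.

Lemma entry_colM l t s x : entry_col l (t * s)%g x = entry_col l t (s^-1 x)%g.
Proof. by rewrite /entry_col invMg permM. Qed.

Lemma eq_tabloid l mu t t' :
  tabloid_of l t = tabloid_of mu t' <-> entry_row l t =1 entry_row mu t'.
Proof.
split=> [/ffunP E x|E]; last by apply/ffunP => i; rewrite !ffunE; apply/setP => x;
  rewrite !inE E.
have := E (Ordinal (entry_row_lt l t x)); rewrite !ffunE => /setP/(_ x).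
by rewrite !inE eqxx => /esym/eqP.
Qed.

Lemma tabloid_ofM l t s :
  tabloid_of l (t * s)%g = [ffun i => s @: tabloid_of l t i].
Proof.
apply/ffunP => i; rewrite !ffunE; apply/setP => x.
rewrite inE entry_rowM; apply/idP/imsetP => [rx|[y]].
  by exists (s^-1 x)%g; rewrite ?inE // permKV.
by rewrite inE => ry ->; rewrite permK.
Qed.

Lemma col_stabP l t (s : 'S_n) :
  reflect (forall x, entry_col l t (s x) = entry_col l t x) (s \in col_stab l t).
Proof. by rewrite inE; apply: (iffP forallP) => H x; apply/eqP/H. Qed.

Lemma col_stabV l t (s : 'S_n) : s \in col_stab l t -> (s^-1)%g \in col_stab l t.
Proof.
by move=> /col_stabP sC; apply/col_stabP => x; rewrite -[in RHS](permKV s x) sC.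
Qed.

Lemma col_stabM l t (s s' : 'S_n) :
  s \in col_stab l t -> s' \in col_stab l t -> (s * s')%g \in col_stab l t.
Proof.
by move=> /col_stabP sC /col_stabP sC'; apply/col_stabP => x; rewrite permM sC' sC.
Qed.

Lemma col_stab_mulr l t (s s' : 'S_n) :
  s \in col_stab l t -> ((s * s')%g \in col_stab l t) = (s' \in col_stab l t).
Proof.
move=> sC; apply/idP/idP => [ss'C|]; last exact: col_stabM.
by rewrite -[s'](mulKg s); apply: col_stabM => //; apply: col_stabV.
Qed.

Lemma col_stab_tperm l t x y :
  entry_col l t x = entry_col l t y -> tperm x y \in col_stab l t.
Proof.
by move=> cxy; apply/col_stabP => z; case: tpermP => // ->; rewrite cxy.
Qed.

Lemma col_stabJ l t s g :
  ((g ^ s)%g \in col_stab l (t * s)%g) = (g \in col_stab l t).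
Proof.
have E x : ((g ^ s)%g (s x) = s (g x))%g by rewrite -!permM -conjgC.
apply/col_stabP/col_stabP => H x.
  by have := H (s x); rewrite E !entry_colM !permK.
by rewrite -[x](permKV s) E !entry_colM !permK.
Qed.

Lemma tabloid_dominance l mu t t' i :
  (forall x y, entry_col l t x = entry_col l t y ->
     entry_row mu t' x = entry_row mu t' y -> x = y) ->
  (\sum_(k < i) nth 0 (parts mu) k <= \sum_(k < i) nth 0 (parts l) k)%N.
Proof.
move=> H; rewrite -(card_tableau_rows (entry_tableau l t)).
rewrite -(card_tableau_rows (entry_tableau mu t')).
exact: tableau_dominance (entry_tableau l t) H i.
Qed.

(** The permutation comes from [tableau_column_match]: it sends [x] to the entry of its column in
    [t] whose row in [t'] is the row of [x] in [t]. *)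
Lemma tabloid_column_perm l t t' :
  (forall x y, entry_col l t x = entry_col l t y ->
     entry_row l t' x = entry_row l t' y -> x = y) ->
  exists2 s, s \in col_stab l t & tabloid_of l t' = tabloid_of l (t * s)%g.
Proof.
move=> H.
have eq_rows i : #|[pred x | (entry_row l t' x < i)%N]| =
                 #|[pred x | (entry_row l t x < i)%N]|.
  by rewrite !(card_tableau_rows (entry_tableau _ _)).
have [p pE] := fin_all_exists
  (tableau_column_match (entry_tableau l t) H eq_rows).
have [_ _ _ rc_inj] := entry_tableau l t.
have p_inj : injective p.
  move=> x y pxy; case: (pE x) (pE y) => cx rx [cy ry].
  by apply: rc_inj; rewrite -?rx -?cx pxy.
exists (perm p_inj).
  by apply/col_stabP => x; rewrite permE; case: (pE x).
apply/eq_tabloid => x; rewrite entry_rowM.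
by case: (pE ((perm p_inj)^-1%g x)) => _; rewrite -(permE p_inj) permKV.
Qed.

End Partitions.

(** * The tabloid module *)

Section LinearMaps.

Variables (R : realType) (U W : lmodType R) (f : U -> W).
Hypothesis lin : linear f.

Lemma lin0 : f 0 = 0.
Proof. by have := lin (-1) 0 0; rewrite !scaleN1r oppr0 addNr addr0. Qed.

Lemma linZ a x : f (a *: x) = a *: f x.
Proof. by rewrite -[a *: x]addr0 lin lin0 addr0. Qed.

Lemma lin_sum (I : Type) (r : seq I) (P : pred I) (a : I -> R) (x : I -> U) :
  f (\sum_(i <- r | P i) a i *: x i) = \sum_(i <- r | P i) a i *: f (x i).
Proof.
by elim/big_rec2: _ => [|i y z _ <-]; [exact: lin0 | exact: lin].
Qed.

Lemma lin_sum1 (I : Type) (r : seq I) (P : pred I) (x : I -> U) :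
  f (\sum_(i <- r | P i) x i) = \sum_(i <- r | P i) f (x i).
Proof.
elim/big_rec2: _ => [|i y z _ <-]; first exact: lin0.
by rewrite -[x i]scale1r lin !scale1r.
Qed.

End LinearMaps.

Section TabloidModule.

Variables (R : realType) (n : nat).
Implicit Types (l mu : partn n) (t s : 'S_n) (v w : tabloid_space R n).

Lemma tabloid_act_linear s : linear (@tabloid_act R n s).
Proof. by move=> a v w; apply/ffunP => X; rewrite !ffunE. Qed.

Lemma tabloid_act1 v : tabloid_act 1%g v = v.
Proof.
apply/ffunP => X; rewrite !ffunE; congr (v _); apply/ffunP => i; rewrite ffunE.
rewrite invg1 -[RHS]imset_id; apply: eq_imset => x; exact: perm1.
Qed.

Lemma tabloid_actM s s' v :
  tabloid_act s (tabloid_act s' v) = tabloid_act (s' * s)%g v.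
Proof.
apply/ffunP => X; rewrite !ffunE; congr (v _); apply/ffunP => i; rewrite !ffunE.
by rewrite -imset_comp; apply: eq_imset => x; rewrite invMg permM.
Qed.

Definition dot v w : R := \sum_X (v X : R) * w X.

Definition tdelta (X : tabloid n) : tabloid_space R n :=
  [ffun Y : tabloid n => (Y == X)%:R].

Lemma dotC v w : dot v w = dot w v.
Proof. by apply: eq_bigr => X _; rewrite mulrC. Qed.

Lemma dot_linear v : linear (dot v : tabloid_space R n -> R^o).
Proof.
move=> a w w'; rewrite -[RHS]/(a * dot v w + dot v w') /dot mulr_sumr.
rewrite -big_split /=; apply: eq_bigr => X _ /=.
by rewrite !ffunE mulrDr; congr (_ + _); exact: mulrCA.
Qed.

Lemma dot_deltal X v : dot (tdelta X) v = v X.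
Proof.
rewrite /dot (bigD1 X) //= ffunE eqxx mul1r big1 ?addr0 // => Y /negbTE YX.
by rewrite ffunE YX mul0r.
Qed.

Lemma dot_eq0 v : dot v v = 0 -> v = 0.
Proof.
move/eqP; rewrite psumr_eq0 => [/allP v0|X _]; last by rewrite -expr2 sqr_ge0.
apply/ffunP => X; rewrite ffunE; apply/eqP.
by have := v0 X (mem_index_enum _); rewrite mulf_eq0 orbb.
Qed.

Lemma dot_ge0 v : 0 <= dot v v.
Proof. by apply: sumr_ge0 => X _; rewrite -expr2 sqr_ge0. Qed.

Lemma dot_act s v w : dot (tabloid_act s v) (tabloid_act s w) = dot v w.
Proof.
rewrite [RHS](reindex_inj (h := fun X : tabloid n => [ffun i => (s^-1)%g @: X i])).
  by apply: eq_bigr => X _; rewrite !ffunE.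
move=> X Y /ffunP E; apply/ffunP => i; have := E i; rewrite !ffunE.
exact/imset_inj/perm_inj.
Qed.

Lemma tabloid_act_delta s l t :
  tabloid_act s (tdelta (tabloid_of l t)) = tdelta (tabloid_of l (t * s)%g).
Proof.
apply/ffunP => Y; rewrite !ffunE; congr (_%:R); apply: congr1.
rewrite tabloid_ofM; apply/eqP/eqP => [<-|->]; apply/ffunP => i; rewrite !ffunE.
  rewrite -imset_comp -[LHS]imset_id; apply: eq_imset => x /=.
  by rewrite permKV.
by rewrite -imset_comp -[RHS]imset_id; apply: eq_imset => x /=; rewrite permK.
Qed.

Definition signed_colsum l t v : tabloid_space R n :=
  \sum_(s in col_stab l t) ((-1) ^+ odd_perm s : R) *: tabloid_act s v.

Lemma polytabloidE l t :
  polytabloid R l t = signed_colsum l t (tdelta (tabloid_of l t)).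
Proof. by apply: eq_bigr => s _; rewrite tabloid_act_delta. Qed.

Lemma signed_colsum_act l t s v : s \in col_stab l t ->
  signed_colsum l t (tabloid_act s v) =
  ((-1) ^+ odd_perm s : R) *: signed_colsum l t v.
Proof.
move=> sC; rewrite /signed_colsum scaler_sumr.
rewrite [RHS](reindex_inj (mulgI s)) /=.
apply: eq_big => [g|g _]; first by rewrite col_stab_mulr.
by rewrite tabloid_actM scalerA odd_permM signr_addb mulrA -signr_addb addbb mul1r.
Qed.

Lemma tabloid_act_polytabloid s l t :
  tabloid_act s (polytabloid R l t) = polytabloid R l (t * s)%g.
Proof.
rewrite !polytabloidE /signed_colsum.
rewrite (lin_sum (tabloid_act_linear s)).
rewrite [RHS](reindex_inj (conjg_inj s)) /=.
apply: eq_big => [g|g _]; first by rewrite col_stabJ.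
by rewrite odd_permJ !tabloid_act_delta -!mulgA -conjgC.
Qed.

(** Two distinct entries sharing a column of [t] and a row of [t'] give a transposition that fixes
    the tabloid of [t'] but reverses the sign of the column sum, which is then its own negative. *)
Lemma signed_colsum_tabloid l mu t t' :
  signed_colsum l t (tdelta (tabloid_of mu t')) <> 0 ->
  forall x y, entry_col l t x = entry_col l t y ->
     entry_row mu t' x = entry_row mu t' y -> x = y.
Proof.
move=> nz x y cxy rxy; apply/eqP; apply: contraPT nz => xy nz; apply: nz.
have /signed_colsum_act := col_stab_tperm cxy.
move/(_ (tdelta (tabloid_of mu t'))).
rewrite tabloid_act_delta odd_tperm xy expr1 scaleN1r.
have /eq_tabloid -> : entry_row mu (t' * tperm x y)%g =1 entry_row mu t'.
  by move=> z; rewrite entry_rowM tpermV; case: tpermP => // ->.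
by move/eqP; rewrite -addr_eq0 -mulr2n -scaler_nat scaler_eq0 pnatr_eq0 => /eqP.
Qed.

Lemma signed_colsum_same l t t' : exists a : R,
  signed_colsum l t (tdelta (tabloid_of l t')) = a *: polytabloid R l t.
Proof.
have [->|nz] := EM (signed_colsum l t (tdelta (tabloid_of l t')) = 0).
  by exists 0; rewrite scale0r.
have [s sC ->] := tabloid_column_perm (signed_colsum_tabloid nz).
exists ((-1) ^+ odd_perm s).
by rewrite -tabloid_act_delta signed_colsum_act // polytabloidE.
Qed.

(** Were some value nonzero on each side, [tabloid_dominance] would make each shape dominate the
    other, and equal partial sums force equal parts. *)
Lemma signed_colsum_neq l mu : l != mu ->
  (forall t t', signed_colsum l t (tdelta (tabloid_of mu t')) = 0) \/
  (forall t t', signed_colsum mu t (tdelta (tabloid_of l t')) = 0).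
Proof.
move=> lmu; have [|/existsNP[t /existsNP[t' /signed_colsum_tabloid H1]]] :=
  EM (forall t t', signed_colsum l t (tdelta (tabloid_of mu t')) = 0); first by left.
right => u u'; apply: contrapT => /signed_colsum_tabloid H2.
move/eqP: lmu; apply; apply: eq_parts => i.
have E k : (\sum_(j < k) nth 0 (parts mu) j = \sum_(j < k) nth 0 (parts l) j)%N.
  by apply/eqP; rewrite eqn_leq (tabloid_dominance _ H1) (tabloid_dominance _ H2).
have := E i.+1; rewrite !big_ord_recr /= E => /addnI //.
Qed.

(** Only the identity preserves both the rows and the columns of [t], so the tabloid of [t] occurs
    once in its polytabloid, with a positive sign. *)
Lemma dot_polytabloid_delta l t :
  dot (polytabloid R l t) (tdelta (tabloid_of l t)) = 1.
Proof.
rewrite dotC dot_deltal /polytabloid sum_ffunE (bigD1 1%g) /=; last first.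
  by apply/col_stabP => x; rewrite perm1.
rewrite !ffunE mulg1 eqxx odd_perm1 scale1r big1 ?addr0 // => s /andP[/col_stabP sC s1].
rewrite !ffunE; case: eqP => [/eq_tabloid E|_]; last by rewrite scaler0.
have [_ _ _ rc_inj] := entry_tableau l t.
case/eqP: s1; apply/permP => x; rewrite perm1; apply: rc_inj; last exact: sC.
by rewrite E entry_rowM permK.
Qed.

End TabloidModule.

(** * Specht modules and invariant forms *)

Section SpechtModule.

Variables (R : realType) (n : nat).
Implicit Types (l mu : partn n) (t s : 'S_n) (v w : tabloid_space R n).

Lemma spechtP l v : v \in specht R l ->
  exists a : 'S_n -> R, v = \sum_t a t *: polytabloid R l t.
Proof.
move/(@coord_span _ _ _ (image_tuple (polytabloid R l) predT)) => E.
exists (fun t => coord (image_tuple (polytabloid R l) predT) (enum_rank t) v).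
rewrite {1}E (reindex (@enum_rank _)) /=; last exact/onW_bij/enum_rank_bij.
apply: eq_bigr => t _; congr (_ *: _).
rewrite (nth_map t) -?cardE //.
by rewrite -[in RHS](enum_rankK t) (enum_val_nth t).
Qed.

Lemma polytabloid_specht l t : polytabloid R l t \in specht R l.
Proof. by apply/memv_span/image_f. Qed.

Lemma specht_act l s v : v \in specht R l -> tabloid_act s v \in specht R l.
Proof.
case/spechtP => a ->; rewrite (lin_sum (tabloid_act_linear s)).
apply: memv_suml => t _; rewrite tabloid_act_polytabloid.
exact/memvZ/polytabloid_specht.
Qed.

Lemma polytabloid_neq0 l t : polytabloid R l t != 0.
Proof.
apply/eqP => e0; have := dot_polytabloid_delta R l t.
by rewrite e0 dotC (lin0 (dot_linear _)) => /esym/eqP; rewrite oner_eq0.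
Qed.

Lemma specht_orthogonal l v : v \in specht R l ->
  (forall t, dot v (polytabloid R l t) = 0) -> v = 0.
Proof.
move=> vS v0; apply: dot_eq0; have [a aE] := spechtP vS.
rewrite {2}aE (lin_sum (dot_linear v)) big1 // => t _; rewrite v0.
exact: mulr0.
Qed.

Section InvariantForm.

Variables (U : lmodType R) (form : tabloid_space R n -> tabloid_space R n -> U).
Hypothesis form_linl : forall w, linear (form^~ w).
Hypothesis form_linr : forall v, linear (form v).
Hypothesis form_act : forall s v w,
  form (tabloid_act s v) (tabloid_act s w) = form v w.

(** The column group and the sign are stable under inversion, so a signed column sum is self-adjoint
    for every invariant form. *)
Lemma form_colsum l t v w :
  form (signed_colsum l t v) w = form v (signed_colsum l t w).
Proof.
rewrite /signed_colsum (lin_sum (form_linl w)) (lin_sum (form_linr v)).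
rewrite (reindex_inj invg_inj) /=; apply: eq_big => s.
  by apply/idP/idP => /col_stabV; rewrite ?invgK.
move=> _; rewrite odd_permV -(form_act s) tabloid_actM mulVg tabloid_act1 //.
Qed.

End InvariantForm.

Lemma dotDl w : linear (fun v => dot v w : R^o).
Proof. by move=> a v v'; rewrite !(dotC _ w) dot_linear. Qed.

Lemma signed_colsum_linear l t : linear (@signed_colsum R n l t).
Proof.
move=> a v w; rewrite /signed_colsum scaler_sumr -big_split.
apply: eq_bigr => s _; rewrite tabloid_act_linear scalerDr /=; congr (_ + _).
by rewrite !scalerA mulrC.
Qed.

(** By [signed_colsum_same] the result is some multiple of the polytabloid. Self-adjointness, tested
    against the tabloid of [t], identifies the coefficient, because this tabloid has coefficient 1
    in the polytabloid. *)
Lemma signed_colsum_specht l t v : v \in specht R l ->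
  signed_colsum l t v = dot v (polytabloid R l t) *: polytabloid R l t.
Proof.
move=> vS; have [a aE] : exists a, signed_colsum l t v = a *: polytabloid R l t.
  have [b ->] := spechtP vS.
  have /fin_all_exists[c cE] := @signed_colsum_same R n l t.
  exists (\sum_t' b t' * \sum_(s in col_stab l t') (-1) ^+ odd_perm s * c (t' * s)%g).
  rewrite (lin_sum (signed_colsum_linear l t)) scaler_suml.
  apply: eq_bigr => t' _; rewrite /polytabloid (lin_sum (signed_colsum_linear l t)).
  rewrite -scalerA scaler_suml; congr (_ *: _); apply: eq_bigr => s _.
  by rewrite -scalerA -cE.
have := form_colsum dotDl (@dot_linear R n) (@dot_act R n) l t v (tdelta R (tabloid_of l t)).
rewrite -polytabloidE aE -[_ *: _]addr0 dotDl => <-.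
rewrite dot_polytabloid_delta dotC (lin0 (dot_linear _)) !addr0.
by congr (_ *: _); exact/esym/mulr1.
Qed.

Lemma signed_colsum_specht_neq l mu :
  (forall t t', signed_colsum l t (tdelta R (tabloid_of mu t')) = 0) ->
  forall t t', signed_colsum l t (polytabloid R mu t') = 0.
Proof.
move=> H t t'; rewrite /polytabloid (lin_sum (signed_colsum_linear l t)).
by rewrite big1 // => s _; rewrite [signed_colsum _ _ _]H scaler0.
Qed.

Section InvariantFormSpecht.

Variables (U : lmodType R) (form : tabloid_space R n -> tabloid_space R n -> U).
Hypothesis form_linl : forall w, linear (form^~ w).
Hypothesis form_linr : forall v, linear (form v).
Hypothesis form_act : forall s v w,
  form (tabloid_act s v) (tabloid_act s w) = form v w.

Lemma form_specht_neq l mu v w :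
  l != mu -> v \in specht R l -> w \in specht R mu -> form v w = 0.
Proof.
move=> lmu /spechtP[a ->] /spechtP[b ->].
rewrite (lin_sum (form_linl _)) big1 // => t _.
rewrite (lin_sum (form_linr _)) big1 ?scaler0 // => t' _.
suff -> : form (polytabloid R l t) (polytabloid R mu t') = 0 by rewrite scaler0.
(* One of the two column sums annihilates the other module; it is extracted from the polytabloid on
   its own side and moved across the form. *)
have [/signed_colsum_specht_neq H|/signed_colsum_specht_neq H] :=
    signed_colsum_neq R lmu.
  by rewrite polytabloidE form_colsum // H (lin0 (form_linr _)).
by rewrite [X in form _ X]polytabloidE -form_colsum // H (lin0 (form_linl _)).
Qed.

(** The constant is the form at a tabloid and its own polytabloid. By invariance it is the same for
    all tableaux, so the identity tableau serves for all of them. *)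
Lemma form_specht l : exists u, forall v w,
  v \in specht R l -> w \in specht R l -> form v w = dot v w *: u.
Proof.
exists (form (tdelta R (tabloid_of l 1%g)) (polytabloid R l 1%g)).
move=> v w vS wS; have [a ->] := spechtP vS.
rewrite (lin_sum (form_linl _)) (lin_sum (dotDl _)) scaler_suml.
apply: eq_bigr => t _; rewrite -[RHS]scalerA; congr (_ *: _).
rewrite {1}polytabloidE form_colsum // signed_colsum_specht //.
rewrite (linZ (form_linr _)) dotC; congr (_ *: _).
by rewrite -[RHS](form_act t) tabloid_act_polytabloid tabloid_act_delta mul1g.
Qed.

End InvariantFormSpecht.

(** A positive multiple of the character of S^l, written as a sum of matrix coefficients instead of
    a trace. *)
Definition specht_class l s : R :=
  \sum_t dot (tabloid_act s (polytabloid R l t)) (polytabloid R l t).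

Lemma specht_classJ l s g : specht_class l (s ^ g)%g = specht_class l s.
Proof.
rewrite /specht_class (reindex_inj (mulIg g)); apply: eq_bigr => t _ /=.
rewrite -tabloid_act_polytabloid tabloid_actM -conjgC -tabloid_actM.
exact: dot_act.
Qed.

Lemma specht_class_orthogonal l mu : l != mu ->
  \sum_s specht_class l s * specht_class mu s = 0.
Proof.
move=> lmu.
(* For fixed [t] and [t'], summing over [s] makes this product of matrix coefficients an invariant
   form, to which [form_specht_neq] applies. *)
pose form t t' v w : R^o := \sum_s
  dot (tabloid_act s v) (polytabloid R l t) *
  dot (tabloid_act s w) (polytabloid R mu t').
transitivity (\sum_t \sum_t' form t t' (polytabloid R l t) (polytabloid R mu t')).
  under [RHS]eq_bigr do rewrite exchange_big /=.
  rewrite exchange_big; apply: eq_bigr => s _ /=.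
  by rewrite mulr_suml; apply: eq_bigr => t _; rewrite mulr_sumr.
rewrite big1 // => t _; rewrite big1 // => t' _.
apply: (form_specht_neq _ _ _ lmu); rewrite ?polytabloid_specht //.
- move=> w a v v'; rewrite -[RHS]/(a * form t t' v w + form t t' v' w).
  rewrite mulr_sumr -big_split; apply: eq_bigr => s _ /=.
  by rewrite tabloid_act_linear dotDl [a *: _]/(a * _) mulrDl mulrA.
- move=> v a w w'; rewrite -[RHS]/(a * form t t' v w + form t t' v w').
  rewrite mulr_sumr -big_split; apply: eq_bigr => s _ /=.
  by rewrite tabloid_act_linear dotDl [a *: _]/(a * _) mulrDr mulrCA.
- move=> s v w; rewrite /form [RHS](reindex_inj (mulgI s)).
  by apply: eq_bigr => g _ /=; rewrite !tabloid_actM.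
Qed.

Lemma specht_class_norm l : \sum_s specht_class l s ^+ 2 != 0.
Proof.
apply: contra (polytabloid_neq0 l 1%g); rewrite psumr_eq0 => [/allP H|s _].
  have := H 1%g (mem_index_enum _); rewrite /= expf_eq0 /= /specht_class.
  rewrite psumr_eq0 => [/allP H'|t _]; last by rewrite tabloid_act1 dot_ge0.
  by have := H' 1%g (mem_index_enum _); rewrite tabloid_act1 => /eqP/dot_eq0 ->.
exact: sqr_ge0.
Qed.

End SpechtModule.

(** * Cycle types *)

Section CycleType.

Variable T : finType.
Implicit Types (s : {perm T}) (x y : T).

Local Open Scope nat_scope.

Lemma perm_iter_eq s x j k :
  ((s ^+ j)%g x == (s ^+ k)%g x) = (j == k %[mod #|porbit s x|]).
Proof.
have c0 : 0 < #|porbit s x| by rewrite lt0n card_porbit_neq0.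
have red i : (s ^+ i)%g x = nth x (traject s x #|porbit s x|) (i %% #|porbit s x|).
  rewrite nth_traject ?ltn_mod // {1}(divn_eq i #|porbit s x|) expgD permM.
  rewrite !permX; congr iter; elim: (i %/ _) => [|q IHq] //.
  by rewrite mulSn addnC iterD iter_porbit.
by rewrite !red nth_uniq ?size_traject ?ltn_mod ?uniq_traject_porbit.
Qed.

Definition sorted_porbits s : seq {set T} :=
  sort (fun A B : {set T} => #|B| <= #|A|) (enum (porbits s)).

Definition cycle_type s : seq nat := [seq #|A| | A : {set T} <- sorted_porbits s].

Lemma mem_sorted_porbits s A : (A \in sorted_porbits s) = (A \in porbits s).
Proof. by rewrite mem_sort mem_enum. Qed.

Lemma cycle_type_partition s :
  [/\ sorted geq (cycle_type s), all (fun k => 0 < k) (cycle_type s)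
    & sumn (cycle_type s) = #|T|].
Proof.
split.
- rewrite /cycle_type sorted_map.
  by apply: (@sort_sorted _ (relpre (fun A : {set T} => #|A|) geq)) => A B;
    apply: leq_total.
- apply/allP => _ /mapP[A + ->]; rewrite mem_sorted_porbits => /imsetP[x _ ->].
  by rewrite lt0n card_porbit_neq0.
rewrite sumnE big_map (perm_big _ (permEl (perm_sort _ _))) big_enum /=.
rewrite -[RHS]sum1_card (partition_big (porbit s) (mem (porbits s))) /=; last first.
  by move=> x _; apply: imset_f.
apply: eq_bigr => _ /imsetP[x _ ->].
by rewrite -sum1_card; apply: eq_bigl => y; rewrite eq_porbit_mem.
Qed.

(** Orbits are paired by their position in the lists sorted by size, and a base point is picked in
    each. The point [j] steps along an orbit of [s] goes to the point [j] steps along the paired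
    orbit of [s']. *)
Lemma cycle_type_conj s s' : cycle_type s = cycle_type s' ->
  exists g, s' = (s ^ g)%g.
Proof.
move=> ct.
have sizeE : size (sorted_porbits s) = size (sorted_porbits s').
  by rewrite -(size_map (fun A : {set T} => #|A|)) [map _ _]ct size_map.
pose pos x := index (porbit s x) (sorted_porbits s).
have orbP x : porbit s x \in sorted_porbits s.
  by rewrite mem_sorted_porbits imset_f.
have pos_lt x : pos x < size (sorted_porbits s) by rewrite index_mem.
pose image x := nth set0 (sorted_porbits s') (pos x).
have imageP x : image x \in sorted_porbits s' by apply: mem_nth; rewrite -sizeE.
have card_image x : #|image x| = #|porbit s x|.
  rewrite /image -(nth_map _ 0 (fun A : {set T} => #|A|)) -?sizeE //.
  by rewrite -[map _ _]ct (nth_map set0) // nth_index.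
(* A relation at first, since [j] is determined only modulo the orbit length; paired orbits have the
   same length, so any choice is consistent. *)
pose rel x y := exists z z' j,
  [/\ [pick u in porbit s x] = Some z, [pick u in image x] = Some z',
      x = (s ^+ j)%g z & y = (s' ^+ j)%g z'].
have relP x : exists y, rel x y.
  case Ez: [pick u in porbit s x] => [z|]; last first.
    by move: Ez; case: pickP => // /(_ x); rewrite porbit_id.
  case Ez': [pick u in image x] => [z'|]; last first.
    move: Ez'; case: pickP => // /eq_card0 E _.
    by have := card_porbit_neq0 s x; rewrite -card_image E.
  have : x \in porbit s z.
    by rewrite porbit_sym; move: Ez; case: pickP => // u ux [<-].
  by case/porbitP => j xj; exists ((s' ^+ j)%g z'), z, z', j.
have rel_orbit x y : rel x y -> image x = porbit s' y.
  case=> z [z' [j [_ + _ ->]]]; rewrite porbit_perm; case: pickP => // u ux [uz].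
  move: (imageP x) ux; rewrite mem_sorted_porbits => /imsetP[w _ ->].
  by rewrite uz -eq_porbit_mem => /eqP.
(* Used twice below: [k = 0] gives the injectivity of the chosen map [g], and [k = 1] shows that it
   conjugates [s] to [s']. *)
have rel_shift x y x2 y2 k : rel x y -> rel x2 y2 -> porbit s x = porbit s x2 ->
    ((s ^+ k)%g x == x2) = ((s' ^+ k)%g y == y2).
  move=> rxy rxy2 E; have Ei : image x = image x2 by rewrite /image /pos E.
  have orb := rel_orbit _ _ rxy; have cx := card_image x.
  case: rxy rxy2 => z [z' [j [ez ez' xj yj]]] [w [w' [j' []]]].
  rewrite -E -Ei ez ez' => -[<-] [<-] -> ->.
  rewrite xj yj -!permM -!expgD !perm_iter_eq.
  by move: orb cx; rewrite xj yj !porbit_perm => -> ->.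
have [g gP] := fin_all_exists relP.
have g_inj : injective g.
  move=> x x2 E; have := rel_shift _ _ _ _ 0 (gP x) (gP x2).
  rewrite !expg0 !perm1 E eqxx => /(_ _)/eqP; apply.
  have := rel_orbit _ _ (gP x); rewrite E -(rel_orbit _ _ (gP x2)) /image => /eqP.
  rewrite nth_uniq -?sizeE // ?sort_uniq ?enum_uniq // => /eqP Epos.
  by rewrite -(nth_index set0 (orbP x)) -[index _ _]/(pos x) Epos nth_index.
exists (perm g_inj); apply/permP => y.
have -> : y = g ((perm g_inj)^-1%g y) by rewrite -(permE g_inj) permKV.
set x := fun_of_perm _ y; rewrite conjgE !permM -{2}(permE g_inj) permK permE.
have := rel_shift _ _ _ _ 1 (gP x) (gP (s x)).
have -> : porbit s (s x) = porbit s x by have := porbit_perm s 1 x; rewrite expg1.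
by rewrite !expg1 eqxx => /(_ erefl)/esym/eqP.
Qed.

End CycleType.

Lemma is_partition_parts n (c : seq nat) : is_partition n c ->
  exists l : partn n, parts l = c.
Proof.
move=> pc; have [sc pos /eqP sumc] := and3P pc.
have size_c : (size c <= n)%N.
  rewrite -sumc; elim: c pos {pc sc sumc} => //= k c IHc /andP[k0 /IHc].
  by rewrite -(leq_add2l 1) add1n => /leq_trans -> //; rewrite leq_add2r.
have lt_c k : k \in c -> (k < n.+1)%N.
  rewrite ltnS -sumc; elim: c {pc sc pos sumc size_c} => //= a c IHc.
  rewrite inE => /predU1P[->|/IHc]; first exact: leq_addr.
  by move=> /leq_trans -> //; apply: leq_addl.
have valK : map (@nat_of_ord n.+1) (map (@inord n) c) = c.
  by rewrite -map_comp map_id_in // => k /lt_c /= /inordK.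
have size_b : (size (map (@inord n) c) <= n)%N by rewrite size_map.
have pb : is_partition n (map val (Bseq size_b)) by rewrite [map _ _]valK.
by exists (exist _ (Bseq size_b) pb).
Qed.

(** Class functions thereby become functions on partitions, which gives as many coordinates as there
    are functions [specht_class]. *)
Lemma cycle_shape_exists n : exists shape : 'S_n -> partn n,
  forall s s', shape s = shape s' -> exists g, s' = (s ^ g)%g.
Proof.
have shapeP (s : 'S_n) : exists l : partn n, parts l = cycle_type s.
  apply: is_partition_parts; have [ct_sorted ct_pos ct_sum] := cycle_type_partition s.
  by rewrite /is_partition ct_sorted ct_pos ct_sum card_ord eqxx.
have [shape shapeE] := fin_all_exists shapeP.
by exists shape => s s' E; apply: cycle_type_conj; rewrite -!shapeE E.
Qed.

(** * Decomposition along Specht modules *)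

(** A linear relation between the rows of [M] is one between class functions, and pairing it with
    one of them isolates a single coefficient by orthogonality. Hence [M] is invertible and the
    indicator of the identity can be solved for. *)
Lemma specht_class_span (R : realType) (n : nat) : exists c : partn n -> R,
  forall s : 'S_n, \sum_l c l * specht_class R l s = (s == 1%g)%:R.
Proof.
have [shape shapeP] := cycle_shape_exists n.
(* A partition that is the shape of no permutation gets the value 0, which keeps [M] square. *)
pose F l k : R :=
  if [pick s | shape s == k] is Some s then specht_class R l s else 0.
have FE l s : F l (shape s) = specht_class R l s.
  rewrite /F; case: pickP => [s' /eqP /shapeP[g ->]|/(_ s)]; last by rewrite eqxx.
  by rewrite specht_classJ.
pose M : 'M[R]_#|partn n| := \matrix_(i, j) F (enum_val i) (enum_val j).
have ME (u : 'rV[R]_#|partn n|) s :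
    (u *m M) 0 (enum_rank (shape s)) =
    \sum_l u 0 (enum_rank l) * specht_class R l s.
  rewrite mxE [RHS](reindex (@enum_val _ predT)) /=; last exact/onW_bij/enum_val_bij.
  by apply: eq_bigr => i _; rewrite mxE enum_rankK FE enum_valK.
have M_unit : M \in unitmx.
  rewrite -row_free_unit -kermx_eq0; apply/eqP/row_matrixP => i; rewrite row0.
  have: row i (kermx M) *m M = 0 by rewrite -row_mul mulmx_ker row0.
  move: (row _ _) => u uM; apply/rowP => j; rewrite mxE -[j]enum_valK.
  move: (enum_val j) => mu.
  have := specht_class_norm R mu; apply: contraNeq => u0.
  have : \sum_s (\sum_l u 0 (enum_rank l) * specht_class R l s) *
      specht_class R mu s = 0.
    by rewrite big1 // => s _; rewrite -ME uM mxE mul0r.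
  under eq_bigr do rewrite mulr_suml.
  rewrite exchange_big /= (bigD1 mu) //= [X in _ + X]big1 ?addr0 => [|l lmu].
    under eq_bigr do rewrite -mulrA -expr2.
    by rewrite -mulr_sumr => /eqP; rewrite mulf_eq0 (negPf u0).
  under eq_bigr do rewrite -mulrA.
  by rewrite -mulr_sumr specht_class_orthogonal ?mulr0.
pose e := (\row_j (j == enum_rank (shape 1%g))%:R) *m invmx M : 'rV[R]__.
exists (fun l => e 0 (enum_rank l)) => s.
rewrite -ME mulmxKV // mxE (inj_eq enum_rank_inj); congr ((nat_of_bool _)%:R).
apply/eqP/eqP => [/shapeP[g]|-> //]; move/(congr1 (conjg^~ g^-1%g)).
by rewrite conjgK conj1g.
Qed.

(** * Equivariant maps from Specht modules *)

Section SpechtMap.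

Variables (R : realType) (n : nat).
Implicit Types (l mu : partn n) (t s : 'S_n) (v w y : tabloid_space R n).

Lemma tabloid_act_col l t s : s \in col_stab l t ->
  tabloid_act s (polytabloid R l t) =
  ((-1) ^+ odd_perm s : R) *: polytabloid R l t.
Proof.
move=> sC; rewrite !polytabloidE /signed_colsum (lin_sum (tabloid_act_linear s)).
rewrite scaler_sumr [RHS](reindex_inj (mulIg s)) /=; apply: eq_big => [g|g _].
  apply/idP/idP => [gC|gsC]; first exact: col_stabM.
  by rewrite -[g](mulgK s); apply: col_stabM => //; apply: col_stabV.
by rewrite tabloid_actM scalerA odd_permM signr_addb mulrCA -signr_addb addbb mulr1.
Qed.

Section OneModule.

Variables (U : lmodType R) (act : 'S_n -> U -> U).

Definition is_action : Prop :=
  [/\ forall s, linear (act s), forall x, act 1%g x = x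
    & forall s s' x, act s (act s' x) = act (s' * s)%g x].

Hypothesis actP : is_action.

Let act_lin s : linear (act s). Proof. by case: actP. Qed.

(** Some column sum sends [y] to a nonzero multiple of a polytabloid. So [phi] kills this
    polytabloid, and then its translates, which span S^l; in effect, this is the irreducibility of
    S^l. *)
Lemma equivariant_inj l (phi : tabloid_space R n -> U) y :
  linear phi -> (forall s v, phi (tabloid_act s v) = act s (phi v)) ->
  y \in specht R l -> phi y = 0 -> y != 0 ->
  forall z, z \in specht R l -> phi z = 0.
Proof.
move=> phi_lin phi_act yS phiy y0 z.
have [t nz] : exists t, dot y (polytabloid R l t) <> 0.
  by apply/existsNP => H; case/eqP: y0; apply: specht_orthogonal yS H.
have phi_e : phi (polytabloid R l t) = 0.
  have := signed_colsum_specht t yS; move/(congr1 phi).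
  rewrite /signed_colsum (lin_sum phi_lin) (linZ phi_lin) big1 => [|s _].
    by move/esym/eqP; rewrite scaler_eq0 => /orP[/eqP|/eqP].
  by rewrite phi_act phiy (lin0 (act_lin s)) scaler0.
case/spechtP => a ->; rewrite (lin_sum phi_lin) big1 // => t' _.
rewrite -[t'](mulKVg t) -tabloid_act_polytabloid phi_act phi_e.
by rewrite (lin0 (act_lin _)) scaler0.
Qed.

Definition specht_map l t (x : U) y : U :=
  \sum_s dot y (tabloid_act s (polytabloid R l t)) *: act s x.

Lemma specht_map_linear l t x : linear (specht_map l t x).
Proof.
move=> a v w; rewrite /specht_map scaler_sumr -big_split; apply: eq_bigr => s _ /=.
by rewrite dotDl scalerDl scalerA.
Qed.

Lemma specht_map_linearl l t y : linear (specht_map l t ^~ y).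
Proof.
move=> a x x'; rewrite /specht_map scaler_sumr -big_split; apply: eq_bigr => s _ /=.
by rewrite act_lin scalerDr !scalerA mulrC.
Qed.

Lemma specht_map_act l t x s y :
  specht_map l t x (tabloid_act s y) = act s (specht_map l t x y).
Proof.
case: actP => _ _ actM; rewrite /specht_map (lin_sum (act_lin s)).
rewrite (reindex_inj (mulIg s)); apply: eq_bigr => g _ /=.
by rewrite actM -tabloid_actM dot_act.
Qed.

(** Translating the summation variable by [s] leaves [x] alone but negates the polytabloid, so the
    sum equals its opposite. *)
Lemma specht_map_fixed l t x y s : s \in col_stab l t -> odd_perm s ->
  act s x = x -> specht_map l t x y = 0.
Proof.
case: actP => _ _ actM sC s_odd sx; apply/eqP.
suff E : specht_map l t x y = - specht_map l t x y.
  have /eqP := E; rewrite -addr_eq0 -mulr2n -scaler_nat scaler_eq0 pnatr_eq0 //.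
rewrite {1}/specht_map (reindex_inj (mulgI s)) -sumrN; apply: eq_bigr => g _ /=.
rewrite -actM sx -tabloid_actM tabloid_act_col // s_odd expr1 scaleN1r -scaleNr.
congr (_ *: _); rewrite -scaleN1r (linZ (tabloid_act_linear g)).
by rewrite (linZ (dot_linear _)) [_ *: _]mulN1r.
Qed.

Lemma sum_specht_map l x :
  \sum_t specht_map l t x (polytabloid R l t) =
  \sum_s specht_class R l s *: act s x.
Proof.
rewrite /specht_map exchange_big; apply: eq_bigr => s _ /=.
by rewrite -scaler_suml; congr (_ *: _); apply: eq_bigr => t _; rewrite dotC.
Qed.

Lemma specht_map_decomposition : exists c : partn n -> R, forall x,
  x = \sum_l \sum_t specht_map l t x (c l *: polytabloid R l t).
Proof.
have [c cE] := specht_class_span R n; exists c => x.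
under eq_bigr do under eq_bigr do rewrite (linZ (specht_map_linear _ _ _)).
under eq_bigr do rewrite -scaler_sumr sum_specht_map scaler_sumr.
rewrite exchange_big (bigD1 1%g) //= [X in _ + X]big1 => [|s /negPf s1].
  under eq_bigr do rewrite scalerA.
  by rewrite -scaler_suml cE eqxx scale1r addr0; case: actP => _ ->.
under eq_bigr do rewrite scalerA.
by rewrite -scaler_suml cE s1 scale0r.
Qed.

Section Isotypic.

Variable V : U -> Prop.

Let iso l := isotypic act (@tabloid_act R n) V (fun v => v \in specht R l).

Lemma isotypic0 l : iso l 0.
Proof.
by exists 0%N, (fun _ => 0); split=> [|[]//]; rewrite big_ord0.
Qed.

Lemma isotypicD l (x y : U) : iso l x -> iso l y -> iso l (x + y).
Proof.
move=> [k [u [-> uP]]] [k' [u' [-> uP']]].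
exists (k + k')%N, (fun i => match split i with inl j => u j | inr j => u' j end).
split=> [|i]; last by case: (split i).
rewrite big_split_ord /=; congr (_ + _); apply: eq_bigr => i _.
  by rewrite (unsplitK (inl i)).
by rewrite (unsplitK (inr i)).
Qed.

Lemma isotypic_sum l (I : Type) (r : seq I) (P : pred I) (x : I -> U) :
  (forall i, P i -> iso l (x i)) -> iso l (\sum_(i <- r | P i) x i).
Proof.
move=> H; elim/big_rec: _ => [|i y Pi]; [exact: isotypic0 | exact/isotypicD/H].
Qed.

Hypothesis V0 : V 0.
Hypothesis V_lin : forall (a : R) (x y : U), V x -> V y -> V (a *: x + y).

(** When nonzero, the map is injective on S^l by [equivariant_inj], so its image is a copy of S^l
    inside [V]. *)
Lemma specht_map_isotypic l t x y :
  (forall s, V (act s x)) -> y \in specht R l -> iso l (specht_map l t x y).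
Proof.
move=> Vx yS; have [->|nz] := eqVneq (specht_map l t x y) 0; first exact: isotypic0.
exists 1%N, (fun=> specht_map l t x y); split=> [|_]; first by rewrite big_ord1.
pose im z := exists2 v, v \in specht R l & specht_map l t x v = z.
have map_inj v v' : v \in specht R l -> v' \in specht R l ->
    specht_map l t x v = specht_map l t x v' -> v = v'.
  move=> vS v'S E; apply/eqP; rewrite -subr_eq0; apply: contraNT nz => vv'.
  apply/eqP/(@equivariant_inj l _ (v - v')) => //.
  - exact: specht_map_linear.
  - exact: specht_map_act.
  - exact: memvB.
  - rewrite -scaleN1r addrC (specht_map_linear l t x) E scaleN1r addNr //.
(* The isomorphism has to go from the image to S^l, so an inverse is chosen on the image; its values
   elsewhere are arbitrary. *)
have /choice[phi phiP] : forall z, exists v, im z ->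
    v \in specht R l /\ specht_map l t x v = z.
  move=> z; have [[v vS vz]|nim] := EM (im z); first by exists v.
  by exists 0 => /nim.
exists im; split.
- split=> [|a _ _ [v vS <-] [v' v'S <-]|s _ [v vS <-]].
  + by exists 0; [exact: mem0v | rewrite (lin0 (specht_map_linear _ _ _))].
  + exists (a *: v + v'); last exact: specht_map_linear.
    by apply: memvD => //; apply: memvZ.
  + by exists (tabloid_act s v); [exact: specht_act | exact: specht_map_act].
- move=> _ [v _ <-]; rewrite /specht_map; elim/big_rec: _ => // s z _.
  exact: V_lin.
- exists phi; split.
  + move=> a z z' iz iz'; have [pS pE] := phiP _ iz; have [pS' pE'] := phiP _ iz'.
    have S' : a *: phi z + phi z' \in specht R l by apply: memvD => //; apply: memvZ.
    have E' : specht_map l t x (a *: phi z + phi z') = a *: z + z'.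
      by rewrite (specht_map_linear l t x) pE pE'.
    have [|qS qE] := phiP (a *: z + z'); first by exists (a *: phi z + phi z').
    by apply: map_inj => //; rewrite qE E'.
  + move=> s z iz; have [pS pE] := phiP _ iz.
    have S' : tabloid_act s (phi z) \in specht R l by apply: specht_act.
    have E' : specht_map l t x (tabloid_act s (phi z)) = act s z.
      by rewrite specht_map_act pE.
    have [|qS qE] := phiP (act s z); first by exists (tabloid_act s (phi z)).
    by apply: map_inj => //; rewrite qE E'.
  + move=> z iz pz; have [_ <-] := phiP _ iz; rewrite pz.
    exact: lin0 (specht_map_linear _ _ _).
  + move=> v; split=> [vS|[z iz <-]]; last by case: (phiP _ iz).
    have iv : im (specht_map l t x v) by exists v.
    exists (specht_map l t x v) => //; have [qS qE] := phiP _ iv.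
    exact: map_inj.
- by exists y.
Qed.

End Isotypic.

End OneModule.

Lemma tabloid_is_action : is_action (@tabloid_act R n).
Proof.
by split; [exact: tabloid_act_linear | exact: tabloid_act1 | exact: tabloid_actM].
Qed.

(** The isomorphism of each piece with S^mu reduces the claim to an element [z] of S^mu itself.
    There, the map followed by the inner product is an invariant form on S^l x S^mu, hence zero, and
    the image of [y] is orthogonal to itself. *)
Lemma specht_map_neq (U : lmodType R) (act : 'S_n -> U -> U) (V : U -> Prop)
    l mu t x y :
  is_action act ->
  l != mu -> isotypic act (@tabloid_act R n) V (fun v => v \in specht R mu) x ->
  y \in specht R l -> specht_map act l t x y = 0.
Proof.
move=> actP lmu [k [u [-> uP]]] yS.
rewrite (lin_sum1 (specht_map_linearl actP l t y)) big1 // => i _.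
have [W [[W0 W_lin W_act] _ [phi [phi_lin phi_act phi_inj phi_onto]] Wu]] := uP i.
(* [phi] is linear on [W] only, so the membership of the partial sums is carried along. *)
have W_sum (I : Type) (r : seq I) (a : I -> R) (z : I -> U) :
    (forall j, W (z j)) -> W (\sum_(j <- r) a j *: z j) /\
    phi (\sum_(j <- r) a j *: z j) = \sum_(j <- r) a j *: phi (z j).
  move=> Wz; elim/big_rec2: _ => [|j v v' _ [Wv <-]]; last first.
    by split; [exact: W_lin | exact: phi_lin].
  by split=> //; have := phi_lin (-1) 0 0 W0 W0;
     rewrite scaler0 addr0 scaleN1r addNr.
have Wg s : W (act s (u i)) by apply: W_act.
have [Wm Em] := W_sum _ (index_enum _)
  (fun s => dot y (tabloid_act s (polytabloid R l t))) (fun s => act s (u i)) Wg.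
apply: phi_inj => //; rewrite Em.
under eq_bigr do rewrite phi_act //.
have zS : phi (u i) \in specht R mu by apply/phi_onto; exists (u i).
move: (phi (u i)) zS => z zS.
have mS v : specht_map (@tabloid_act R n) l t z v \in specht R mu.
  by apply: memv_suml => s _; apply/memvZ/specht_act.
apply: dot_eq0.
apply: (form_specht_neq (form := fun v w =>
  dot (specht_map (@tabloid_act R n) l t z v) w : R^o) _ _ _ lmu) (mS y) => //.
- by move=> w a v v'; rewrite specht_map_linear dotDl.
- by move=> v; exact: dot_linear.
- by move=> s v w; rewrite (specht_map_act tabloid_is_action) dot_act.
Qed.

End SpechtMap.

(** * Symmetry-adapted bases *)

(** Expanding [dot] over the tabloids X, the matrix is [c] times the sum of the G_X^T Q G_X, where
    G_X has the entries [g i k X]; the row [r X] is the image of [w] under G_X. *)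
Lemma psd_gram (R : realType) (n N p : nat) (Q : 'M[R]_N) (c : R)
    (g : 'I_N -> 'I_p -> tabloid_space R n) : psd Q -> 0 <= c ->
  psd (\matrix_(k, k') (c * \sum_i \sum_i' Q i i' * dot (g i k) (g i' k'))).
Proof.
move=> [Q_sym Q_psd] c0; split=> [|w].
  apply/matrixP => k k'; rewrite !mxE; congr (_ * _).
  rewrite exchange_big; apply: eq_bigr => i _; apply: eq_bigr => i' _ /=.
  by rewrite dotC -[in LHS]Q_sym mxE.
pose r X : 'rV[R]_N := \row_i \sum_k w 0 k * g i k X.
suff -> : (w *m (\matrix_(k, k')
    (c * \sum_i \sum_i' Q i i' * dot (g i k) (g i' k'))) *m w^T) 0 0 =
    c * \sum_X (r X *m Q *m (r X)^T) 0 0.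
  by apply: mulr_ge0 => //; apply: sumr_ge0 => X _; apply: Q_psd.
have quad q (A : 'M[R]_q) (y : 'rV[R]_q) :
    (y *m A *m y^T) 0 0 = \sum_i \sum_i' y 0 i * A i i' * y 0 i'.
  rewrite exchange_big mxE; apply: eq_bigr => i _ /=.
  by rewrite !mxE mulr_suml.
rewrite quad mulr_sumr; under [RHS]eq_bigr do rewrite quad.
transitivity (\sum_k \sum_k' \sum_X \sum_i \sum_i'
    c * (w 0 k * g i k X * Q i i' * (w 0 k' * g i' k' X))).
  apply: eq_bigr => k _; apply: eq_bigr => k' _; rewrite mxE.
  rewrite [RHS]exchange_big /= mulr_sumr mulr_sumr mulr_suml.
  apply: eq_bigr => i _; rewrite [RHS]exchange_big /=.
  rewrite !mulr_sumr mulr_suml; apply: eq_bigr => i' _.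
  rewrite /dot !mulr_sumr mulr_suml; apply: eq_bigr => X _.
  rewrite -!mulrA; rewrite [LHS]mulrCA; congr (c * (_ * _)).
  by rewrite [RHS]mulrCA; congr (_ * _); congr (_ * _); rewrite mulrC.
under [LHS]eq_bigr do rewrite exchange_big /=.
rewrite [LHS]exchange_big; apply: eq_bigr => X _ /=.
rewrite mulr_sumr.
under [LHS]eq_bigr => k _ do rewrite exchange_big /=.
rewrite [LHS]exchange_big; apply: eq_bigr => i _ /=.
rewrite mulr_sumr.
under [LHS]eq_bigr => k _ do rewrite exchange_big /=.
rewrite [LHS]exchange_big; apply: eq_bigr => i' _ /=.
rewrite /r !mxE mulr_suml mulr_suml mulr_sumr; apply: eq_bigr => k _.
by rewrite !mulr_sumr.
Qed.

Section SymmetryAdapted.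

Variables (R : realType) (n : nat) (U : lmodType R) (act : 'S_n -> U -> U).
Hypothesis actP : is_action act.
Variables (V : U -> Prop) (l : partn n) (m : nat).
Variable b : 'I_m -> (\dim (specht R l)).-tuple U.
Hypothesis bP : symmetry_adapted act V b.

(** Guarantees that the entry 0 of each basis, used in [Ymat], is an actual basis vector and not the
    default of [nth]. *)
Lemma dim_specht_gt0 : (0 < \dim (specht R l))%N.
Proof.
rewrite lt0n dimv_eq0; apply: contraNneq (polytabloid_neq0 R l 1%g) => S0.
by have := polytabloid_specht R l 1%g; rewrite S0 memv0.
Qed.

Lemma symmetry_adapted_isotypic (i : 'I_m) x : lin_span (b i) x ->
  isotypic act (@tabloid_act R n) V (fun v => v \in specht R l) x.
Proof.
move=> bx; have [_ _ [VE _] _] := bP; apply/VE.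
exists (fun k => if k == i then x else 0) => [k|].
  case: eqVneq => [-> //|_]; exists (fun=> 0).
  by rewrite big1 // => j _; rewrite scale0r.
by rewrite -big_mkcond big_pred1_eq.
Qed.

(** In the decomposition of a nonzero [z], the terms of other shapes vanish by [specht_map_neq], so
    some term of shape [l] is nonzero. The image of its map is then a nonzero submodule, and
    irreducibility makes it everything. *)
Lemma symmetry_adapted_generator (i : 'I_m) : exists t x,
  lin_span (b i) x /\
  forall z, lin_span (b i) z ->
    exists2 v, v \in specht R l & specht_map act l t x v = z.
Proof.
have [_ irr _ _] := bP; have [[W0 W_lin W_act] [z Wz z0] W_irr] := irr i.
have [c cE] := specht_map_decomposition actP.
have [t nz] : exists t, specht_map act l t z (c l *: polytabloid R l t) <> 0.
  apply/existsNP => H; case/eqP: z0; rewrite (cE z) big1 // => mu _.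
  rewrite big1 // => t _; have [->|mul] := eqVneq mu l; first exact: H.
  apply: (specht_map_neq _ actP mul (symmetry_adapted_isotypic Wz)).
  exact/memvZ/polytabloid_specht.
exists t, z; split=> //.
have [||all0|//] := W_irr (fun x =>
    exists2 v, v \in specht R l & specht_map act l t z v = x).
- split=> [|a _ _ [v vS <-] [v' v'S <-]|s _ [v vS <-]].
  + by exists 0; [exact: mem0v | rewrite (lin0 (specht_map_linear _ _ _ _))].
  + exists (a *: v + v'); last exact: specht_map_linear.
    by apply: memvD => //; apply: memvZ.
  + by exists (tabloid_act s v); [exact: specht_act | exact: specht_map_act].
- move=> _ [v _ <-]; rewrite /specht_map; elim/big_rec: _ => // s y _ Wy.
  exact/W_lin/Wy/W_act.
- case: nz; apply: all0; exists (c l *: polytabloid R l t) => //.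
  exact/memvZ/polytabloid_specht.
Qed.

(** The [v j] are common to all copies: the [x i] have the same coordinates [c] in every basis, and
    each permutation has the same matrix in all the bases, so the image of [v j] has coordinates
    [D (v j)] independent of [i]. These are read off in the copy [i0]. *)
Lemma symmetry_adapted_param : exists (t : 'S_n) (x : 'I_m -> U)
    (v : 'I_(\dim (specht R l)) -> tabloid_space R n),
  forall j, [/\ v j \in specht R l, v j != 0
    & forall i, specht_map act l t (x i) (v j) = tnth (b i) j].
Proof.
have [b_free _ _ b_mx] := bP.
(* Without copies there is no [i0], and any nonzero vector of S^l serves. *)
case: (posnP m) => [m0|m_gt0].
  exists 1%g, (fun=> 0), (fun=> polytabloid R l 1%g) => j.
  split=> [||[i lt_im]]; [exact: polytabloid_specht | exact: polytabloid_neq0 |].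
  by exfalso; rewrite m0 in lt_im.
pose i0 := Ordinal m_gt0.
have [t [x [[c xE] xP]]] := symmetry_adapted_generator i0.
have b_span j : lin_span (b i0) (tnth (b i0) j).
  exists (fun k => (k == j)%:R); rewrite (bigD1 j) //= eqxx scale1r.
  by rewrite big1 ?addr0 // => k /negPf ->; rewrite scale0r.
have /fin_all_exists2[v vS vE] : forall j, exists2 w, w \in specht R l &
    specht_map act l t x w = tnth (b i0) j by move=> j; apply: xP.
exists t, (fun i => \sum_j c j *: tnth (b i) j), v => j.
have [M ME] := fin_all_exists b_mx.
have act_lin s : linear (act s) by case: actP.
pose D w k := \sum_s \sum_j dot w (tabloid_act s (polytabloid R l t)) *
  (c j * M s k j).
have mapE i w : specht_map act l t (\sum_j c j *: tnth (b i) j) w =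
    \sum_k D w k *: tnth (b i) k.
  rewrite /specht_map.
  under eq_bigr => s _.
    rewrite (lin_sum (act_lin s)).
    under eq_bigr do rewrite ME scaler_sumr.
    rewrite exchange_big scaler_sumr /=.
    under eq_bigr do [rewrite scaler_sumr;
      under eq_bigr do rewrite !scalerA -mulrA; rewrite -scaler_suml].
    over.
  rewrite exchange_big; apply: eq_bigr => k _ /=.
  by rewrite -scaler_suml; congr (_ *: _); apply: eq_bigr.
split=> [//||i].
  apply/eqP => v0; have := vE j; rewrite v0 (lin0 (specht_map_linear _ _ _ _)).
  move=> bj0; have := b_free i0 (fun k => (k == j)%:R).
  rewrite (bigD1 j) //= -bj0 scaler0 add0r big1 => [|k /negPf ->]; last first.
    by rewrite scale0r.
  by move/(_ erefl j); rewrite eqxx => /eqP; rewrite oner_eq0.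
have Dj k : D (v j) k = (k == j)%:R.
  apply/eqP; rewrite -subr_eq0; apply/eqP.
  apply: (b_free i0 (fun k => D (v j) k - (k == j)%:R)).
  under eq_bigr do rewrite scalerBl.
  rewrite sumrB -mapE -xE vE (bigD1 j) //= eqxx scale1r.
  by rewrite big1 ?addr0 ?subrr // => k' /negPf ->; rewrite scale0r.
rewrite mapE; under eq_bigr do rewrite Dj.
rewrite (bigD1 j) //= eqxx scale1r.
by rewrite big1 ?addr0 // => k /negPf ->; rewrite scale0r.
Qed.

Section InvariantForm.

Variables (U' : lmodType R) (form : U -> U -> U').
Hypothesis form_linl : forall y, linear (form^~ y).
Hypothesis form_linr : forall x, linear (form x).
Hypothesis form_act : forall s x y, form (act s x) (act s y) = form x y.

Lemma specht_map_form t t' mu mu' x x' :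
  let F v w := form (specht_map act mu t x v) (specht_map act mu' t' x' w) in
  [/\ forall w, linear (F^~ w), forall v, linear (F v)
    & forall s v w, F (tabloid_act s v) (tabloid_act s w) = F v w].
Proof.
split=> [w a v v'|v a w w'|s v w] /=.
- by rewrite specht_map_linear form_linl.
- by rewrite specht_map_linear form_linr.
- by rewrite !specht_map_act.
Qed.

Lemma symmetry_adapted_form :
  exists (v : 'I_(\dim (specht R l)) -> tabloid_space R n) (u : 'I_m -> 'I_m -> U'),
  (forall j, v j != 0) /\
  forall i i' j j',
    form (tnth (b i) j) (tnth (b i') j') = dot (v j) (v j') *: u i i'.
Proof.
have [t [x [v vP]]] := symmetry_adapted_param.
have H i i' : exists u, forall w w', w \in specht R l -> w' \in specht R l ->
    form (specht_map act l t (x i) w) (specht_map act l t (x i') w') = dot w w' *: u.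
  by have [Fl Fr Fa] := specht_map_form t t l l (x i) (x i');
    apply: form_specht.
have [u uE] := fin_all_exists (fun i => fin_all_exists (H i)).
exists v, u; split=> [j|i i' j j']; first by case: (vP j).
by have [vS _ <-] := vP j; have [vS' _ <-] := vP j'; exact: uE.
Qed.

(** The coefficients of [z i], transported to the common vectors of [symmetry_adapted_form], give
    vectors [g i k], and both sides become combinations of the constants [u k k']. The factor [d^-1]
    cancels the squared norm of [v j0] that comes with the first basis vectors. *)
Lemma isotypic_sos (N : nat) (Q : 'M[R]_N) (z : 'I_N -> U) : psd Q ->
  (forall i, isotypic act (@tabloid_act R n) V (fun v => v \in specht R l) (z i)) ->
  exists2 Qm : 'M[R]_m, psd Qm &
    \sum_i \sum_i' Q i i' *: form (z i) (z i') =
    \sum_k \sum_k' Qm k k' *: form (b k)`_0 (b k')`_0.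
Proof.
move=> Q_psd z_iso; have [v [u [v0 uE]]] := symmetry_adapted_form.
have [_ _ [VE _] _] := bP.
have zE i : exists G : 'I_m -> 'I_(\dim (specht R l)) -> R,
    z i = \sum_k \sum_j G k j *: tnth (b k) j.
  have /VE[w wE ->] := z_iso i; have [G GE] := fin_all_exists wE.
  by exists G; apply: eq_bigr.
have [G GE] := fin_all_exists zE.
pose j0 := Ordinal dim_specht_gt0; pose d := dot (v j0) (v j0).
have d0 : d != 0 by apply: contraNneq (v0 j0) => /dot_eq0 ->.
pose g i k := \sum_j G i k j *: v j.
exists (\matrix_(k, k') (d^-1 * \sum_i \sum_i' Q i i' * dot (g i k) (g i' k'))).
  by apply: psd_gram; rewrite // invr_ge0 dot_ge0.
have formE i i' : form (z i) (z i') =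
    \sum_k \sum_k' dot (g i k) (g i' k') *: u k k'.
  rewrite {1}GE (lin_sum1 (form_linl _)); apply: eq_bigr => k _.
  rewrite GE (lin_sum1 (form_linr _)); apply: eq_bigr => k' _.
  rewrite (lin_sum (form_linl _)) (lin_sum (dotDl _)) scaler_suml.
  apply: eq_bigr => j _.
  rewrite (lin_sum (form_linr _)) (lin_sum (dot_linear _)) -scalerA; congr (_ *: _).
  by rewrite scaler_suml; apply: eq_bigr => j' _; rewrite uE scalerA.
have YE k k' : form (b k)`_0 (b k')`_0 = d *: u k k'.
  by rewrite -uE !(tnth_nth 0).
transitivity (\sum_i \sum_i' \sum_k \sum_k' (Q i i' * dot (g i k) (g i' k')) *: u k k').
  apply: eq_bigr => i _; apply: eq_bigr => i' _; rewrite formE scaler_sumr.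
  by apply: eq_bigr => k _; rewrite scaler_sumr; apply: eq_bigr => k' _; rewrite scalerA.
under eq_bigr do rewrite exchange_big /=.
rewrite exchange_big; apply: eq_bigr => k _ /=.
under eq_bigr do rewrite exchange_big /=.
rewrite exchange_big; apply: eq_bigr => k' _ /=.
rewrite mxE YE scalerA mulrAC mulVf // mul1r scaler_suml; apply: eq_bigr => i _.
by rewrite scaler_suml.
Qed.

End InvariantForm.

End SymmetryAdapted.

(** * Edge polynomials and flag densities *)

Section Lex.

Local Open Scope nat_scope.

Lemma lex_ge_ones (s : seq nat) k :
  all (fun i => 0 < i) s -> sumn s = k -> lex_ge s (nseq k 1).
Proof.
rewrite /lex_ge; elim: k s => [|k IHk] [|a s] //= /andP[a0 s0].
rewrite lexi_cons leEnat a0 /= => sum_s; apply/implyP => a1.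
by apply: IHk => //; case: a a0 a1 sum_s => [|[|a]] //= _ _ [].
Qed.

(** A first part larger than [n - t] decides at once; if it equals [n - t], the other parts sum to
    [t] and are compared with ones. *)
Lemma lex_ge_hook n t (l : partn n) : t <= n -> n - t <= nth 0 (parts l) 0 ->
  lex_ge (parts l) (hook n t).
Proof.
move=> tn; have [_ pos suml] := partsP l.
have ones : [seq k <- nseq t 1 | 0 < k] = nseq t 1.
  by apply/all_filterP/allP => k /nseqP[->].
(* For [t = n] the null part is filtered out and the hook consists of ones only. *)
rewrite /hook /= ones; case: posnP => [nt0 _|nt0].
  by apply: lex_ge_ones => //; apply/eqP; rewrite suml eqn_leq tn andbT -subn_eq0 nt0.
case: (parts l) pos suml => [|a s] /=; first by rewrite leqNgt nt0.
move=> /andP[_ s0] suml le_a; rewrite /lex_ge lexi_cons leEnat le_a /=.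
apply/implyP => ge_a; apply: lex_ge_ones => //.
have Ea : a = n - t by apply/eqP; rewrite eqn_leq le_a ge_a.
by apply: (@addnI a); rewrite suml Ea subnK.
Qed.

Lemma column_collision n (l : partn n) (s : 'S_n) (C : {set 'I_n}) :
  nth 0 (parts l) 0 < #|C| ->
  exists x y, [/\ x \in C, y \in C, x != y & entry_col l s x = entry_col l s y].
Proof.
move=> lt_C; have /existsP[x /existsP[y /and4P[? ? ? /eqP ?]]] :
    [exists x, exists y, [&& x \in C, y \in C, x != y
       & entry_col l s x == entry_col l s y]]; last by exists x, y.
apply: contraLR lt_C => /existsPn nex; rewrite -leqNgt.
rewrite cardE -(size_map (entry_col l s)) -[leqRHS](size_iota 0).
have [srt cl _ _] := entry_tableau l s.
apply: uniq_leq_size => [|k /mapP[x _ ->]]; last first.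
  by rewrite mem_iota; apply: leq_trans (cl x) _; apply: nth_sorted_geq.
rewrite map_inj_in_uniq ?enum_uniq // => x y; rewrite !mem_enum => xC yC E.
apply/eqP; apply: contraT => xy; move/existsPn/(_ y): (nex x).
by rewrite xC yC xy E eqxx.
Qed.

End Lex.

Section EdgePolynomials.

Variables (R : realType) (n : nat).
Implicit Types (p q : edgepoly R n) (s : 'S_n).

Lemma xvar_edge (e : edge n) :
  xvar R (val e).1 (val e).2 = 'X_(enum_rank e) /\
  xvar R (val e).2 (val e).1 = 'X_(enum_rank e).
Proof.
rewrite /xvar -surjective_pairing valK; split=> //.
by case: insubP => //= e'; rewrite ltnNge (ltnW (valP e)).
Qed.

Lemma xvar_diag (i : 'I_n) : xvar R i i = 0.
Proof. by rewrite /xvar !insubF //= ltnn. Qed.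

Lemma xvarC (i j : 'I_n) : xvar R i j = xvar R j i.
Proof.
by case: (ltngtP i j) => [lt_ij|lt_ji|/val_inj-> //];
  [have [-> ->] := xvar_edge (exist _ (i, j) lt_ij)
  |have [-> ->] := xvar_edge (exist _ (j, i) lt_ji)].
Qed.

Lemma edge_act_linear s : linear (@edge_act R n s).
Proof. by move=> a p q; rewrite /edge_act comp_mpolyD comp_mpolyZ. Qed.

Lemma edge_actMr s : {morph @edge_act R n s : p q / p * q}.
Proof. by move=> p q; rewrite /edge_act rmorphM. Qed.

Lemma edge_act_xvar s (i j : 'I_n) :
  edge_act s (xvar R i j) = xvar R (s i) (s j).
Proof.
have H (e : edge n) : edge_act s (xvar R (val e).1 (val e).2) =
    xvar R (s (val e).1) (s (val e).2).
  case: (xvar_edge e) => -> _; rewrite /edge_act comp_mpolyXU -tnth_nth tnth_mktuple.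
  by rewrite enum_rankK.
case: (ltngtP i j) => [lt_ij|lt_ji|/val_inj->].
- exact: H (exist _ (i, j) lt_ij).
- by rewrite xvarC [RHS]xvarC; exact: H (exist _ (j, i) lt_ji).
- by rewrite !xvar_diag (lin0 (edge_act_linear s)).
Qed.

Lemma edge_act_is_action : is_action (@edge_act R n).
Proof.
split=> [s|p|s s' p]; first exact: edge_act_linear.
  rewrite /edge_act -[RHS]comp_mpoly_id; congr comp_mpoly.
  apply: eq_from_tnth => k; rewrite !tnth_mktuple !perm1.
  by case: (xvar_edge (enum_val k)) => -> _; rewrite enum_valK.
rewrite [edge_act s' p]/edge_act comp_mpolyE [RHS]/edge_act comp_mpolyE.
rewrite (lin_sum (edge_act_linear s)); apply: eq_bigr => m _; congr (_ *: _).
rewrite {1}/edge_act rmorph_prod; apply: eq_bigr => k _.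
by rewrite rmorphXn !tnth_mktuple !permM; congr (_ ^+ _); exact: edge_act_xvar.
Qed.

Lemma edge_act_flag_mono s f (F : sgraph f) (h : 'I_f -> 'I_n) :
  edge_act s (flag_mono R F h) = flag_mono R F (fun i => s (h i)).
Proof.
rewrite /flag_mono edge_actMr {1 2}/edge_act !rmorph_prod.
congr (_ * _); apply: eq_bigr => e _; first exact: edge_act_xvar.
by rewrite rmorphB rmorph1; congr (1 - _); exact: edge_act_xvar.
Qed.

(** Composition with [s] is a bijection from the extensions of [Theta] to those of the permuted map,
    so the normalizing factor agrees too. *)
Lemma edge_act_density s t (T : sgraph t) f (F : flag T f) (Theta : 'I_t -> 'I_n) :
  edge_act s (density R F Theta) = density R F (fun i => s (Theta i)).
Proof.
pose post (h : {ffun 'I_f -> 'I_n}) := [ffun i => s (h i)].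
have post_inj : injective post.
  move=> h h' /ffunP E; apply/ffunP => i; have := E i; rewrite !ffunE.
  exact: perm_inj.
have E : Inj_ext F (fun i => s (Theta i)) = post @: Inj_ext F Theta.
  apply/setP => h; apply/idP/imsetP => [|[h0]]; rewrite !inE.
    case/andP => /injectiveP h_inj /forallP hT; exists [ffun i => (s^-1)%g (h i)].
      rewrite !inE; apply/andP; split.
        by apply/injectiveP => i j; rewrite !ffunE => /perm_inj/h_inj.
      by apply/forallP => i; rewrite ffunE (eqP (hT i)) permK.
    by apply/ffunP => i; rewrite !ffunE permKV.
  case/andP => /injectiveP h_inj /forallP hT ->; apply/andP; split.
    by apply/injectiveP => i j; rewrite !ffunE => /perm_inj/h_inj.
  by apply/forallP => i; rewrite ffunE (eqP (hT i)).
rewrite /density (linZ (edge_act_linear s)) E card_imset //; congr (_ *: _).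
rewrite big_imset /=; last by move=> ? ? _ _; apply: post_inj.
rewrite (lin_sum1 (edge_act_linear s)); apply: eq_bigr => h _.
rewrite edge_act_flag_mono /flag_mono; congr (_ * _); apply: eq_bigr => e _;
by rewrite !ffunE.
Qed.

(** The invariant bilinear form to which the lemmas on forms are applied; its values on the first
    basis vectors are the entries of [Ymat]. *)
Definition sym_product p q : edgepoly R n :=
  (n`!%:R^-1 : R) *: \sum_s edge_act s (p * q).

Lemma sym_product_linearl q : linear (sym_product^~ q).
Proof.
move=> a x y; rewrite /sym_product scalerA [a * _]mulrC -scalerA -scalerDr; congr (_ *: _).
rewrite scaler_sumr -big_split; apply: eq_bigr => s _ /=.
by rewrite mulrDl -scalerAl edge_act_linear.
Qed.

Lemma sym_product_linearr p : linear (sym_product p).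
Proof.
move=> a x y; rewrite /sym_product scalerA [a * _]mulrC -scalerA -scalerDr; congr (_ *: _).
rewrite scaler_sumr -big_split; apply: eq_bigr => s _ /=.
by rewrite mulrDr -scalerAr edge_act_linear.
Qed.

Lemma sym_product_act s p q : sym_product (edge_act s p) (edge_act s q) = sym_product p q.
Proof.
rewrite /sym_product; congr (_ *: _); rewrite [RHS](reindex_inj (mulgI s)).
apply: eq_bigr => g _ /=; case: edge_act_is_action => _ _ actM.
by rewrite -edge_actMr actM.
Qed.

Lemma Ymat_sym_product m k (b : 'I_m -> k.-tuple (edgepoly R n)) i j :
  Ymat b i j = sym_product (b i)`_0 (b j)`_0.
Proof. by rewrite mxE. Qed.

(** The symmetric group permutes the injective maps [Theta], so the sum over them is invariant and
    equals its own average over the group. *)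
Lemma expected_sosE t (T : sgraph t) f N (Fl : 'I_N -> flag T f) (Q : 'M[R]_N) :
  expected_sos n Fl Q = (#|Inj t n|%:R^-1 : R) *: \sum_(Theta in Inj t n)
    \sum_i \sum_j Q i j *:
      sym_product (density R (Fl i) Theta) (density R (Fl j) Theta).
Proof.
rewrite /expected_sos; congr (_ *: _).
pose G (Theta : 'I_t -> 'I_n) := \sum_i \sum_j Q i j *:
  (density R (Fl i) Theta * density R (Fl j) Theta).
have G_act s Theta : edge_act s (G Theta) = G (fun i => s (Theta i)).
  rewrite (lin_sum1 (edge_act_linear s)); apply: eq_bigr => i _.
  rewrite (lin_sum (edge_act_linear s)); apply: eq_bigr => j _.
  by rewrite edge_actMr !edge_act_density.
transitivity (\sum_(Theta in Inj t n) (n`!%:R^-1 : R) *: \sum_s edge_act s (G Theta));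
  last first.
  apply: eq_bigr => Theta _; rewrite /sym_product.
  under eq_bigr do rewrite (lin_sum1 (edge_act_linear _)).
  rewrite exchange_big scaler_sumr; apply: eq_bigr => i _ /=.
  under eq_bigr do rewrite (lin_sum (edge_act_linear _)).
  rewrite exchange_big scaler_sumr; apply: eq_bigr => j _ /=.
  by rewrite -scaler_sumr !scalerA mulrC.
apply: esym; rewrite -scaler_sumr exchange_big /=.
have E s : \sum_(Theta in Inj t n) edge_act s (G Theta) = \sum_(Theta in Inj t n) G Theta.
  pose post (h : {ffun 'I_t -> 'I_n}) := [ffun i => s (h i)].
  have post_inj : injective post.
    move=> h h' /ffunP E; apply/ffunP => i; have := E i; rewrite !ffunE.
    exact: perm_inj.
  rewrite [RHS](reindex_inj post_inj); apply: eq_big => [Theta|Theta _].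
    rewrite !inE; apply/injectiveP/injectiveP => Th_inj i j.
      by rewrite !ffunE => /perm_inj/Th_inj.
    by move=> ij; apply: Th_inj; rewrite !ffunE ij.
  by rewrite G_act; congr G; apply/funext => i; rewrite ffunE.
under eq_bigr do rewrite E.
rewrite sumr_const card_Sn -scaler_nat scalerA mulVf ?scale1r //.
by rewrite pnatr_eq0 -lt0n fact_gt0.
Qed.

Lemma psd_sum (I : finType) (P : pred I) (c : R) k (Qm : I -> 'M[R]_k) :
  0 <= c -> (forall i, psd (Qm i)) -> psd (c *: \sum_(i | P i) Qm i).
Proof.
move=> c0 Q_psd; split=> [|v].
  rewrite linearZ linear_sum; congr (_ *: _).
  by apply: eq_bigr => i _; case: (Q_psd i).
rewrite -scalemxAr -scalemxAl mxE; apply: mulr_ge0 => //.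
rewrite mulmx_sumr mulmx_suml summxE; apply: sumr_ge0 => i _.
by case: (Q_psd i).
Qed.

End EdgePolynomials.

(** * The sum of squares for a single map [Theta] *)

Section DensityDecomposition.

Variables (R : realType) (n t f d N : nat) (T : sgraph t) (Fl : 'I_N -> flag T f).
Variables (Q : 'M[R]_N) (m : partn n -> nat).
Variable b : forall l : partn n,
  'I_(m l) -> (\dim (specht R l)).-tuple (edgepoly R n).
Hypothesis tn : (t <= n)%N.
Hypothesis Q_psd : psd Q.
Hypothesis Fl_deg : forall (Theta : 'I_t -> 'I_n) (i : 'I_N), injective Theta ->
  (msize (density R (Fl i) Theta) <= d.+1)%N.
Hypothesis bP : forall l : partn n,
  symmetry_adapted (@edge_act R n) (@poly_le R n d) (@b l).

Lemma density_specht_map (l : partn n) (s : 'S_n) (F : flag T f)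
    (Theta : 'I_t -> 'I_n) v :
  injective Theta -> ~~ lex_ge (parts l) (hook n t) ->
  specht_map (@edge_act R n) l s (density R F Theta) v = 0.
Proof.
move=> Th_inj nlex; pose C := ~: [set Theta i | i : 'I_t].
have cardC : #|C| = (n - t)%N by rewrite cardsCs setCK card_imset // !card_ord.
have [|x [y [xC yC xy cxy]]] := @column_collision n l s C.
  by rewrite cardC ltnNge; apply: contra nlex; apply: lex_ge_hook.
apply: (specht_map_fixed (edge_act_is_action R n) _ (col_stab_tperm cxy)).
  by rewrite odd_tperm.
(* Both points lie outside the image of [Theta], so their transposition fixes the density. *)
rewrite edge_act_density; congr density; apply/funext => i.
have nC z : z \in C -> z != Theta i.
  by rewrite inE; apply: contraNneq => ->; apply: imset_f.
by rewrite tpermD // nC.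
Qed.

Lemma density_sos (Theta : 'I_t -> 'I_n) : injective Theta ->
  exists2 Qm : forall l : partn n, 'M[R]_(m l), forall l, psd (Qm l) &
    \sum_i \sum_j Q i j *:
      sym_product (density R (Fl i) Theta) (density R (Fl j) Theta) =
    \sum_(l : partn n | lex_ge (parts l) (hook n t)) mxpair (Qm l) (Ymat (@b l)).
Proof.
move=> Th_inj; have actP := edge_act_is_action R n.
have [c cE] := specht_map_decomposition actP.
(* The component of shape [l] of the density of the flag [Fl i]. *)
pose z l i := \sum_s specht_map (@edge_act R n) l s (density R (Fl i) Theta)
  (c l *: polytabloid R l s).
have z_iso l i : isotypic (@edge_act R n) (@tabloid_act R n) (@poly_le R n d)
    (fun v => v \in specht R l) (z l i).
  apply: isotypic_sum => s _; apply: specht_map_isotypic => //.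
  - by rewrite /poly_le msize0.
  - move=> a p q p_le q_le; apply: leq_trans (msizeD_le _ _) _.
    by rewrite geq_max q_le andbT; apply: leq_trans (msizeZ_le _ _) _.
  (* The translates are densities of injective maps again, so the degree bound covers them. *)
  - move=> g; rewrite edge_act_density; apply: Fl_deg => i1 i2 /perm_inj.
    exact: Th_inj.
  - exact/memvZ/polytabloid_specht.
have /fin_all_exists2[Qm Qm_psd QmE] := fun l => isotypic_sos actP (bP l)
  (@sym_product_linearl R n) (@sym_product_linearr R n) (@sym_product_act R n)
  Q_psd (z_iso l).
exists Qm => //.
transitivity (\sum_(l : partn n | lex_ge (parts l) (hook n t))
    \sum_i \sum_j Q i j *: sym_product (z l i) (z l j)); last first.
  apply: eq_bigr => l _; rewrite QmE; apply: eq_bigr => k _.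
  by apply: eq_bigr => k' _; rewrite Ymat_sym_product.
have z0 l i : ~~ lex_ge (parts l) (hook n t) -> z l i = 0.
  by move=> nlex; apply: big1 => s _; apply: density_specht_map.
(* Distinct shapes are orthogonal for [sym_product], so the double sum over shapes reduces to its
   diagonal. *)
have z_orth l mu i j : l != mu -> sym_product (z l i) (z mu j) = 0.
  move=> lmu; rewrite (lin_sum1 (sym_product_linearl _)) big1 // => s _.
  rewrite (lin_sum1 (sym_product_linearr _)) big1 // => s' _.
  have [Fl_l Fl_r Fl_act] := specht_map_form actP (@sym_product_linearl R n)
    (@sym_product_linearr R n) (@sym_product_act R n) s s' l mu
    (density R (Fl i) Theta) (density R (Fl j) Theta).
  by apply: (form_specht_neq Fl_l Fl_r Fl_act lmu);
    apply/memvZ/polytabloid_specht.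
rewrite [RHS]exchange_big; apply: eq_bigr => i _ /=.
rewrite [RHS]exchange_big; apply: eq_bigr => j _ /=.
rewrite -scaler_sumr; congr (_ *: _).
rewrite {1}[density R (Fl i) Theta]cE {1}[density R (Fl j) Theta]cE.
rewrite -/(z^~ i) (lin_sum1 (sym_product_linearl _)) [RHS]big_mkcond /=.
apply: eq_bigr => l _; rewrite (lin_sum1 (sym_product_linearr _)).
rewrite (bigD1 l) //= [X in _ + X]big1 ?addr0 => [|mu mul]; last first.
  by apply: z_orth; rewrite eq_sym.
case: ifPn => // /z0 zl0.
by rewrite [X in sym_product X _]zl0 (lin0 (sym_product_linearl _)).
Qed.

End DensityDecomposition.

Unset Implicit Arguments.

Theorem theorem4p13 (R : realType) (a : nat) (A : sgraph a)
    (n t f d N : nat) (T : sgraph t) (Fl : 'I_N -> flag T f) (Q : 'M[R]_N)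
    (m : partn n -> nat)
    (b : forall l : partn n,
       'I_(m l) -> (\dim (specht R l)).-tuple (edgepoly R n)) :
  (1 <= t)%N -> (t <= f)%N -> (f <= n)%N ->
  flag_enumeration A Fl ->
  psd Q ->
  (forall (Theta : 'I_t -> 'I_n) (i : 'I_N), injective Theta ->
     (msize (density R (Fl i) Theta) <= d.+1)%N) ->
  (forall l : partn n,
     symmetry_adapted (@edge_act R n) (@poly_le R n d) (b l)) ->
  exists Qm : forall l : partn n, 'M[R]_(m l),
    (forall l : partn n, lex_ge (parts l) (hook n t) -> psd (Qm l)) /\
    expected_sos n Fl Q =
      \sum_(l : partn n | lex_ge (parts l) (hook n t))
        mxpair (Qm l) (Ymat (b l)).
Proof.
move=> _ tf fn _ Q_psd Fl_deg bP.
have tn := leq_trans tf fn.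
have H (Theta : {ffun 'I_t -> 'I_n}) : exists Qm : forall l : partn n, 'M[R]_(m l),
    (forall l, psd (Qm l)) /\ (Theta \in Inj t n ->
    \sum_i \sum_j Q i j *:
      sym_product (density R (Fl i) Theta) (density R (Fl j) Theta) =
    \sum_(l : partn n | lex_ge (parts l) (hook n t)) mxpair (Qm l) (Ymat (b l))).
  (* A map that is not injective receives zero matrices, so that the choice can be made over all
     finite functions. *)
  have [|nTh] := boolP (Theta \in Inj t n); last first.
    exists (fun=> 0); split=> // l; split=> [|v]; first exact: trmx0.
    by rewrite mulmx0 mul0mx mxE.
  rewrite inE => /injectiveP Th_inj.
  by have [Qm ? ?] := density_sos tn Q_psd Fl_deg bP Th_inj; exists Qm.
have [Qm QmP] := fin_all_exists H.
(* Averaging the matrices over the injective maps preserves positivity and commutes with the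
   pairing, which is linear in the matrix. *)
exists (fun l => #|Inj t n|%:R^-1 *: \sum_(Theta in Inj t n) Qm Theta l); split.
  by move=> l _; apply: psd_sum => [|Theta]; [rewrite invr_ge0 | case: (QmP Theta)].
rewrite expected_sosE.
under eq_bigr => Theta Th_in do rewrite (proj2 (QmP Theta) Th_in).
rewrite exchange_big scaler_sumr; apply: eq_bigr => l _ /=.
rewrite exchange_big scaler_sumr; apply: eq_bigr => i _ /=.
rewrite exchange_big scaler_sumr; apply: eq_bigr => j _ /=.
by rewrite -scaler_suml scalerA; congr (_ *: _); rewrite [RHS]mxE summxE.
Qed.
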